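(* Let the fans $\Sigma_i(k)$ in $\mathbb{R}^2$, the admissibility conditions, and the octagons $\Delta_i(k,\ell_1,\ldots,\ell_6)$ ($1\le i\le 15$, $k\in\mathbb{Z}$) be those listed in the context. (1) Every smooth projective toric surface of Picard rank $6$ is isomorphic to the toric surface of the fan $\Sigma_i(k)$ for some $i\in\{1,\ldots,15\}$ and some $k\in\mathbb{Z}$; equivalently, its fan is the image of some $\Sigma_i(k)$ under an element of $\mathrm{GL}_2(\mathbb{Z})$. (2) For every $i\in\{1,\ldots,15\}$ and $k\in\mathbb{Z}$, every Kähler class on the smooth projective toric surface with fan $\Sigma_i(k)$ corresponds to a Delzant octagon $\Delta_i(k,\ell_1,\ldots,\ell_6)$ for some admissible parameters $(\ell_1,\ldots,\ell_6)$. In terms of polygons: every convex polygon with inner normal fan $\Sigma_i(k)$ is a translate of $\Delta_i(k,\ell_1,\ldots,\ell_6)$ for some admissible $(\ell_1,\ldots,\ell_6)$. (3) Conversely, for every $i\in\{1,\ldots,15\}$, $k\in\mathbb{Z}$ and admissible $(\ell_1,\ldots,\ell_6)$, the polygon $\Delta_i(k,\ell_1,\ldots,\ell_6)$ corresponds to a Kähler class on the smooth projective toric surface of Picard rank $6$ with fan $\Sigma_i(k)$; that is, it is a Delzant octagon with inner normal fan $\Sigma_i(k)$.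
   Context: **Fans.** Write $e_1=(1,0)$, $e_2=(0,1)$ and $v_k=(-1,k)=-e_1+ke_2$ for $k\in\mathbb{Z}$. For primitive vectors $u_1,\ldots,u_r\in\mathbb{Z}^2$, $\mathrm{Fan}(u_1,\ldots,u_r)$ denotes the complete fan in $\mathbb{R}^2$ whose rays are exactly those generated by $u_1,\ldots,u_r$. Complete toric surfaces are encoded by complete rational fans in $\mathbb{R}^2$ up to the action of $\mathrm{GL}_2(\mathbb{Z})$. The surface is smooth if and only if the primitive generators of any two adjacent rays form a basis of $\mathbb{Z}^2$; in that case its Picard rank is the number of rays minus $2$. **Polygons and Kähler classes.** The inner normal fan of a convex polygon is the complete fan whose rays are generated by the primitive inner normals of its edges. A convex polygon with rational edge normals is Delzant if for any two adjacent edges the primitive inner normals form a basis of $\mathbb{Z}^2$. Kähler classes (with real coefficients) on a smooth projective toric surface with fan $\Sigma$ correspond to convex polygons (with arbitrary real vertices) with inner normal fan $\Sigma$, up to translation in the plane. **The fans $\Sigma_i(k)$.** - $\Sigma_1(k)=\mathrm{Fan}(\pm e_2,e_1,v_k,v_k+e_2,v_k+2e_2,v_k+3e_2,v_k+4e_2)$ - $\Sigma_2(k)=\mathrm{Fan}(\pm e_2,e_1,v_k,v_k+e_2,v_k+2e_2,v_k+3e_2,2v_k+e_2)$ - $\Sigma_3(k)=\mathrm{Fan}(\pm e_2,e_1,v_k,v_k+e_2,v_k+2e_2,v_k+3e_2,2v_k+3e_2)$ - $\Sigma_4(k)=\mathrm{Fan}(\pm e_2,e_1,v_k,v_k+e_2,v_k+2e_2,2v_k+e_2,3v_k+2e_2)$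 - $\Sigma_5(k)=\mathrm{Fan}(\pm e_2,e_1,v_k,v_k+e_2,v_k+2e_2,2v_k+e_2,3v_k+e_2)$ - $\Sigma_6(k)=\mathrm{Fan}(\pm e_2,e_1,v_k,v_k+e_2,v_k+2e_2,2v_k+e_2,2v_k+3e_2)$ - $\Sigma_7(k)=\mathrm{Fan}(\pm e_2,e_1,v_k,v_k+e_2,2v_k+e_2,3v_k+e_2,4v_k+e_2)$ - $\Sigma_8(k)=\mathrm{Fan}(\pm e_2,e_1,v_k,v_k+e_2,2v_k+e_2,3v_k+e_2,5v_k+2e_2)$ - $\Sigma_9(k)=\mathrm{Fan}(\pm e_2,e_1,v_k,v_k+e_2,2v_k+e_2,3v_k+e_2,3v_k+2e_2)$ - $\Sigma_{10}(k)=\mathrm{Fan}(\pm e_2,e_1,e_1-e_2,v_k,v_k+e_2,v_k+2e_2,v_k+3e_2)$ - $\Sigma_{11}(k)=\mathrm{Fan}(\pm e_2,e_1,e_1-e_2,v_k,v_k+e_2,v_k+2e_2,2v_k+e_2)$ - $\Sigma_{12}(k)=\mathrm{Fan}(\pm e_2,e_1,e_1-e_2,v_k,v_k+e_2,2v_k+e_2,3v_k+e_2)$ - $\Sigma_{13}(k)=\mathrm{Fan}(\pm e_2,e_1,e_1-e_2,e_1-2e_2,v_k,v_k+e_2,v_k+2e_2)$ - $\Sigma_{14}(k)=\mathrm{Fan}(\pm e_2,e_1,e_1-e_2,e_1-2e_2,v_k,v_k+e_2,2v_k+e_2)$ - $\Sigma_{15}(k)=\mathrm{Fan}(\pm e_2,e_1,e_1-e_2,2e_1-e_2,v_k,v_k+e_2,2v_k+e_2)$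 **The octagons $\Delta_i(k,\ell_1,\ldots,\ell_6)$.** The parameters $\ell_1,\ldots,\ell_6$ are positive real numbers. They are the lattice lengths, in counterclockwise order, of the six edges not containing the vertex $(0,0)$. They are called admissible (for $i$ and $k$) if they are positive and satisfy the conditions listed below. Each octagon is the convex hull of the listed vertices, given in counterclockwise order, in terms of the following vectors $a=(a_j)_{1\le j\le m}$ and $b=(b_j)_{1\le j\le m}$. Put $B=\sum_{j=1}^m b_j\ell_j$. *Families $i=1,\ldots,9$* ($m=5$). - $i=1$: $a=(k+4,k+3,k+2,k+1,k)$, $b=(1,1,1,1,1)$ - $i=2$: $a=(k+3,k+2,k+1,2k+1,k)$, $b=(1,1,1,2,1)$ - $i=3$: $a=(k+3,k+2,2k+3,k+1,k)$, $b=(1,1,2,1,1)$ - $i=4$: $a=(k+2,k+1,3k+2,2k+1,k)$, $b=(1,1,3,2,1)$ - $i=5$: $a=(k+2,k+1,2k+1,3k+1,k)$, $b=(1,1,2,3,1)$ - $i=6$: $a=(k+2,2k+3,k+1,2k+1,k)$, $b=(1,2,1,2,1)$ - $i=7$: $a=(k+1,2k+1,3k+1,4k+1,k)$, $b=(1,2,3,4,1)$ - $i=8$: $a=(k+1,2k+1,5k+2,3k+1,k)$, $b=(1,2,5,3,1)$ - $i=9$: $a=(k+1,3k+2,2k+1,3k+1,k)$, $b=(1,3,2,3,1)$ Condition: $\ell_6>\sum_{j=1}^5 a_j\ell_j$. Vertices: $(0,0)$; then $\bigl(\ell_6-\sum_{j=s+1}^{5}a_j\ell_j,\ \sum_{j=1}^{s}b_j\ell_j\bigr)$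 for $s=0,1,\ldots,5$; then $(0,B)$. *Families $i=10,11,12$* ($m=4$). - $i=10$: $a=(k+3,k+2,k+1,k)$, $b=(1,1,1,1)$ - $i=11$: $a=(k+2,k+1,2k+1,k)$, $b=(1,1,2,1)$ - $i=12$: $a=(k+1,2k+1,3k+1,k)$, $b=(1,2,3,1)$ Conditions: $\ell_6+\ell_5>\sum_{j=1}^4a_j\ell_j$ and $B>\ell_6$. Vertices: $(0,0)$; then $\bigl(\ell_6+\ell_5-\sum_{j=s+1}^{4}a_j\ell_j,\ \sum_{j=1}^{s}b_j\ell_j\bigr)$ for $s=0,\ldots,4$; then $(\ell_6,B)$; then $(0,B-\ell_6)$. *Families $i=13,14$* ($m=3$). - $i=13$: $a=(k+2,k+1,k)$, $b=(1,1,1)$ - $i=14$: $a=(k+1,2k+1,k)$, $b=(1,2,1)$ Conditions: $\ell_6+2\ell_5+\ell_4>\sum_{j=1}^3a_j\ell_j$ and $B>\ell_5+\ell_6$. Vertices: $(0,0)$; then $\bigl(\ell_6+2\ell_5+\ell_4-\sum_{j=s+1}^{3}a_j\ell_j,\ \sum_{j=1}^{s}b_j\ell_j\bigr)$ for $s=0,\ldots,3$; then $(\ell_6+2\ell_5,B)$; $(\ell_6,B-\ell_5)$; $(0,B-\ell_5-\ell_6)$. *Family $i=15$* ($m=3$): $a=(k+1,2k+1,k)$, $b=(1,2,1)$. Conditions: $\ell_4+\ell_5+\ell_6>\sum_{j=1}^3a_j\ell_j$ and $B>\ell_5+2\ell_6$. Vertices: $(0,0)$; then $\bigl(\ell_6+\ell_4+\ell_5-\sum_{j=s+1}^{3}a_j\ell_j,\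 \sum_{j=1}^{s}b_j\ell_j\bigr)$ for $s=0,\ldots,3$; then $(\ell_6+\ell_5,B)$; $(\ell_6,B-\ell_5)$; $(0,B-\ell_5-2\ell_6)$. *)

(* Defs.v *)
From mathcomp Require Import all_boot all_order all_algebra.
From mathcomp Require Import boolp classical_sets functions cardinality reals.

Set Implicit Arguments.
Unset Strict Implicit.
Unset Printing Implicit Defensive.

Import Order.TTheory GRing.Theory Num.Theory.

Local Open Scope classical_set_scope.
Local Open Scope ring_scope.

Notation lattice := (int * int)%type.
(* R^o is R as a module over itself, so that a *: x makes sense on points. *)
Notation plane R := (R^o * R^o)%type.

Definition toR (R : realType) (u : lattice) : plane R := (u.1%:~R, u.2%:~R).

Definition dot (R : realType) (w x : plane R) : R := w.1 * x.1 + w.2 * x.2.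

Definition primitive (u : lattice) : bool := coprimez u.1 u.2.

Definition Zbasis (u v : lattice) : Prop :=
  forall w : lattice, exists! c : int * int, w = u *~ c.1 + v *~ c.2.

Definition cone (R : realType) (s : seq lattice) : set (plane R) :=
  [set x | exists2 c : 'I_(size s) -> R, forall i, 0 <= c i
         & x = \sum_i c i *: toR R s`_i].
Arguments cone R s : clear implicits.

Definition rational_cone (R : realType) (C : set (plane R)) : Prop :=
  exists s : seq lattice, C = cone R s.

Definition strongly_convex (R : realType) (C : set (plane R)) : Prop :=
  forall x, C x -> C (- x) -> x = 0.

Definition face_of_cone (R : realType) (D C : set (plane R)) : Prop :=
  exists2 w : plane R, forall x, C x -> 0 <= dot w x
         & D = [set x | C x /\ dot w x = 0].

Definition fan (R : realType) (F : set (set (plane R))) : Prop :=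
  [/\ finite_set F,
      forall C, F C -> rational_cone C /\ strongly_convex C,
      forall C D, F C -> face_of_cone D C -> F D
    & forall C D, F C -> F D ->
        face_of_cone (C `&` D) C /\ face_of_cone (C `&` D) D].

Definition complete_fan (R : realType) (F : set (set (plane R))) : Prop :=
  fan F /\ forall x, exists2 C, F C & C x.

Definition ray_generators (R : realType) (F : set (set (plane R))) :
    set lattice :=
  [set u | primitive u /\ F (cone R [:: u])].

(* A description operator: its value is meaningful only when a complete fan
   with these rays exists (such a fan is then unique).  The default value
   set0 is not a complete fan. *)
Definition Fan (R : realType) (us : seq lattice) : set (set (plane R)) :=
  get [set F : set (set (plane R)) |
        complete_fan F /\ ray_generators F = [set` us]].
Arguments Fan R us : clear implicits.

Definition adjacent_rays (R : realType) (F : set (set (plane R)))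
    (u v : lattice) : Prop :=
  [/\ ray_generators F u, ray_generators F v, u <> v & F (cone R [:: u; v])].

Definition smooth_fan (R : realType) (F : set (set (plane R))) : Prop :=
  forall u v, adjacent_rays F u v -> Zbasis u v.

(* The Picard rank of the smooth complete toric surface of F is the number of
   rays minus 2. *)
Definition has_picard_rank (R : realType) (F : set (set (plane R))) (r : nat) :
    Prop :=
  (ray_generators F #= `I_r.+2)%card.

Definition GL2_act (g : 'M[int]_2) (R : realType) (x : plane R) : plane R :=
  ((g 0 0)%:~R * x.1 + (g 0 1)%:~R * x.2,
   (g 1 0)%:~R * x.1 + (g 1 1)%:~R * x.2).

Definition GL2_act_fan (g : 'M[int]_2) (R : realType)
    (F : set (set (plane R))) : set (set (plane R)) :=
  [set GL2_act g (R := R) @` C | C in F].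

Definition conv (R : realType) (s : seq (plane R)) : set (plane R) :=
  [set x | exists c : 'I_(size s) -> R,
    [/\ forall i, 0 <= c i, \sum_i c i = 1 & x = \sum_i c i *: s`_i]].

(* Compact convex polygons, not contained in a line. *)
Definition polygon (R : realType) (P : set (plane R)) : Prop :=
  (exists s, P = conv s) /\
  exists x y z : plane R, [/\ P x, P y, P z &
    (y.1 - x.1) * (z.2 - x.2) - (y.2 - x.2) * (z.1 - x.1) != 0].

Definition polygon_face (R : realType) (P : set (plane R)) (w : plane R) :
    set (plane R) :=
  [set x | P x /\ forall y, P y -> dot w x <= dot w y].

Definition is_inner_normal (R : realType) (P : set (plane R)) (w : plane R) :
    Prop :=
  w <> 0 /\ exists x y, [/\ polygon_face P w x, polygon_face P w y & x <> y].

Definition edges (R : realType) (P : set (plane R)) : set (set (plane R)) :=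
  [set polygon_face P w | w in is_inner_normal P].

Definition octagon (R : realType) (P : set (plane R)) : Prop :=
  polygon P /\ (edges P #= `I_8)%card.

Definition rational_normals (R : realType) (P : set (plane R)) : Prop :=
  forall w, is_inner_normal P w ->
    exists u c, [/\ primitive u, 0 < c & w = c *: toR R u].

Definition primitive_normal (R : realType) (P : set (plane R)) (u : lattice) :
    Prop :=
  primitive u /\ is_inner_normal P (toR R u).

Definition delzant (R : realType) (P : set (plane R)) : Prop :=
  [/\ polygon P, rational_normals P
    & forall u v, primitive_normal P u -> primitive_normal P v -> u <> v ->
        polygon_face P (toR R u) `&` polygon_face P (toR R v) !=set0 ->
        Zbasis u v].

Definition has_inner_normal_fan (R : realType) (P : set (plane R))
    (F : set (set (plane R))) : Prop :=
  [/\ polygon P, rational_normals P, complete_fan F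
    & ray_generators F = primitive_normal P].

(* The toric surface of F is projective iff F is the normal fan of a lattice
   polygon. *)
Definition projective_fan (R : realType) (F : set (set (plane R))) : Prop :=
  exists s : seq lattice, has_inner_normal_fan (conv (map (toR R) s)) F.

Definition smooth_projective_fan (R : realType) (F : set (set (plane R))) :
    Prop :=
  [/\ complete_fan F, smooth_fan F & projective_fan F].

Definition translate (R : realType) (t : plane R) (P : set (plane R)) :
    set (plane R) :=
  [set t + x | x in P].

Definition e1 : lattice := (1, 0).
Definition e2 : lattice := (0, 1).
Definition vk (k : int) : lattice := - e1 + e2 *~ k.

(* In the definitions indexed by i, only 1 <= i <= 15 is meaningful. *)
Definition Sigma_rays (i : nat) (k : int) : seq lattice :=
  let v := vk k in
  [:: e2; - e2; e1] ++
  match i with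
  | 1 => [:: v; v + e2; v + e2 *+ 2; v + e2 *+ 3; v + e2 *+ 4]
  | 2 => [:: v; v + e2; v + e2 *+ 2; v + e2 *+ 3; v *+ 2 + e2]
  | 3 => [:: v; v + e2; v + e2 *+ 2; v + e2 *+ 3; v *+ 2 + e2 *+ 3]
  | 4 => [:: v; v + e2; v + e2 *+ 2; v *+ 2 + e2; v *+ 3 + e2 *+ 2]
  | 5 => [:: v; v + e2; v + e2 *+ 2; v *+ 2 + e2; v *+ 3 + e2]
  | 6 => [:: v; v + e2; v + e2 *+ 2; v *+ 2 + e2; v *+ 2 + e2 *+ 3]
  | 7 => [:: v; v + e2; v *+ 2 + e2; v *+ 3 + e2; v *+ 4 + e2]
  | 8 => [:: v; v + e2; v *+ 2 + e2; v *+ 3 + e2; v *+ 5 + e2 *+ 2]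
  | 9 => [:: v; v + e2; v *+ 2 + e2; v *+ 3 + e2; v *+ 3 + e2 *+ 2]
  | 10 => [:: e1 - e2; v; v + e2; v + e2 *+ 2; v + e2 *+ 3]
  | 11 => [:: e1 - e2; v; v + e2; v + e2 *+ 2; v *+ 2 + e2]
  | 12 => [:: e1 - e2; v; v + e2; v *+ 2 + e2; v *+ 3 + e2]
  | 13 => [:: e1 - e2; e1 - e2 *+ 2; v; v + e2; v + e2 *+ 2]
  | 14 => [:: e1 - e2; e1 - e2 *+ 2; v; v + e2; v *+ 2 + e2]
  | 15 => [:: e1 - e2; e1 *+ 2 - e2; v; v + e2; v *+ 2 + e2]
  | _ => [::]
  end.

Definition Sigma (R : realType) (i : nat) (k : int) : set (set (plane R)) :=
  Fan R (Sigma_rays i k).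

Arguments Sigma R i k : clear implicits.

Definition coef_a (i : nat) (k : int) : seq int :=
  match i with
  | 1 => [:: k + 4; k + 3; k + 2; k + 1; k]
  | 2 => [:: k + 3; k + 2; k + 1; 2 * k + 1; k]
  | 3 => [:: k + 3; k + 2; 2 * k + 3; k + 1; k]
  | 4 => [:: k + 2; k + 1; 3 * k + 2; 2 * k + 1; k]
  | 5 => [:: k + 2; k + 1; 2 * k + 1; 3 * k + 1; k]
  | 6 => [:: k + 2; 2 * k + 3; k + 1; 2 * k + 1; k]
  | 7 => [:: k + 1; 2 * k + 1; 3 * k + 1; 4 * k + 1; k]
  | 8 => [:: k + 1; 2 * k + 1; 5 * k + 2; 3 * k + 1; k]
  | 9 => [:: k + 1; 3 * k + 2; 2 * k + 1; 3 * k + 1; k]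
  | 10 => [:: k + 3; k + 2; k + 1; k]
  | 11 => [:: k + 2; k + 1; 2 * k + 1; k]
  | 12 => [:: k + 1; 2 * k + 1; 3 * k + 1; k]
  | 13 => [:: k + 2; k + 1; k]
  | 14 | 15 => [:: k + 1; 2 * k + 1; k]
  | _ => [::]
  end.

Definition coef_b (i : nat) : seq int :=
  match i with
  | 1 => [:: 1; 1; 1; 1; 1]
  | 2 => [:: 1; 1; 1; 2; 1]
  | 3 => [:: 1; 1; 2; 1; 1]
  | 4 => [:: 1; 1; 3; 2; 1]
  | 5 => [:: 1; 1; 2; 3; 1]
  | 6 => [:: 1; 2; 1; 2; 1]
  | 7 => [:: 1; 2; 3; 4; 1]
  | 8 => [:: 1; 2; 5; 3; 1]
  | 9 => [:: 1; 3; 2; 3; 1]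
  | 10 => [:: 1; 1; 1; 1]
  | 11 => [:: 1; 1; 2; 1]
  | 12 => [:: 1; 2; 3; 1]
  | 13 => [:: 1; 1; 1]
  | 14 | 15 => [:: 1; 2; 1]
  | _ => [::]
  end.

(* Parameters are numbered from 1: ell l j = l_j for 1 <= j <= 6. *)
Definition ell (R : realType) (l : 6.-tuple R) (j : nat) : R := l`_j.-1.

Definition len_m (i : nat) : nat := size (coef_b i).

(* sum_{j=s+1}^m a_j l_j *)
Definition asum (R : realType) (i : nat) (k : int) (l : 6.-tuple R) (s : nat) :
    R :=
  \sum_(s.+1 <= j < (len_m i).+1) ((coef_a i k)`_j.-1)%:~R * ell l j.

(* sum_{j=1}^s b_j l_j *)
Definition bsum (R : realType) (i : nat) (l : 6.-tuple R) (s : nat) : R :=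
  \sum_(1 <= j < s.+1) ((coef_b i)`_j.-1)%:~R * ell l j.

Definition Btot (R : realType) (i : nat) (l : 6.-tuple R) : R :=
  bsum i l (len_m i).

(* The abscissa of the upper end of the chain of edges with parameters
   l_1, ..., l_m. *)
Definition top_right (R : realType) (i : nat) (l : 6.-tuple R) : R :=
  if (i <= 9)%N then ell l 6
  else if (i <= 12)%N then ell l 6 + ell l 5
  else if (i <= 14)%N then ell l 6 + ell l 5 *+ 2 + ell l 4
  else ell l 6 + ell l 4 + ell l 5.

Definition admissible (R : realType) (i : nat) (k : int) (l : 6.-tuple R) :
    Prop :=
  [/\ forall j : 'I_6, 0 < tnth l j,
      asum i k l 0 < top_right i l
    & if (i <= 9)%N then True
      else if (i <= 12)%N then ell l 6 < Btot i l
      else if (i <= 14)%N then ell l 5 + ell l 6 < Btot i l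
      else ell l 5 + ell l 6 *+ 2 < Btot i l].

Definition Delta_vertices (R : realType) (i : nat) (k : int) (l : 6.-tuple R) :
    seq (plane R) :=
  let B := Btot i l in
  [:: (0, 0)] ++
  [seq (top_right i l - asum i k l s, bsum i l s) | s <- iota 0 (len_m i).+1] ++
  if (i <= 9)%N then [:: (0, B)]
  else if (i <= 12)%N then [:: (ell l 6, B); (0, B - ell l 6)]
  else if (i <= 14)%N then
    [:: (ell l 6 + ell l 5 *+ 2, B); (ell l 6, B - ell l 5);
        (0, B - ell l 5 - ell l 6)]
  else
    [:: (ell l 6 + ell l 5, B); (ell l 6, B - ell l 5);
        (0, B - ell l 5 - ell l 6 *+ 2)].

Definition Delta (R : realType) (i : nat) (k : int) (l : 6.-tuple R) :
    set (plane R) :=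
  conv (Delta_vertices i k l).

(* Main.v *)
Require Import Defs.
From mathcomp Require Import all_boot all_order all_algebra.
From mathcomp Require Import boolp classical_sets functions cardinality reals.
From mathcomp Require Import zify ring lra.

(** Parts (2) and (3) rest on a dictionary between complete fans and polygons.  A
    complete fan of the plane is determined by its rays: a strongly convex cone
    is the origin, a ray or a sector, and the sectors of the fan are those
    spanned by two rays with no ray in between ([complete_fanE]).  Let now
    primitive vectors [u 0], ..., [u (n - 1)] turn once around the origin, with
    consecutive minors equal to 1, and let positive lengths close up the path
    whose steps are these vectors turned by a right angle.  Along the path the
    linear form [u j] first increases and then decreases ([vertex_convex]), so
    the path bounds a convex polygon with inner normals [u j].  The normal cones
    of its vertices are the sectors of consecutive normals, and normal cones of
    a polygon cover the plane and meet in common faces, so that these sectors,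
    their sides and the origin form a complete fan ([normal_fan_complete]).
    Conversely, in a polygon with these inner normals the end of each edge is
    the start of the next one ([face_end_next]), so that the polygon is, up to
    translation, traced by its edge lengths ([polygon_of_normals]).  For the
    normals of [Sigma R i k] the closing condition is two linear equations.  They
    give the lengths of the edges through the origin in terms of the other six,
    and the admissibility of these six is the positivity of all eight
    ([closed_lengths], [admissible_lengths]).

    For part (1), a smooth complete fan with more than three rays has two
    opposite rays ([opposite_rays]), which an element of SL2(Z) moves to [e2] and
    [- e2].  The rays in each open half plane then form a chain from [e2] to
    [- e2] with consecutive minors equal to 1 ([left_chain]).  In such a chain a
    vector farthest from the axis is the sum of its neighbours, unless all
    vectors have abscissa -1, and removing it leaves a chain ([chain_contract]).
    Hence the chains are, up to shears, those obtained by inserting sums of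
    neighbours, starting with vertical ones ([chain_forms]).  With eight rays the
    two chains have six vectors in all.  A finite enumeration, up to exchange of
    the two chains and reflection, finds only the fifteen families
    ([forms_match]); a shear normalizes the right chain and leaves the parameter
    [k] to the left one. *)

Set Implicit Arguments.
Unset Strict Implicit.
Unset Printing Implicit Defensive.

Import Order.TTheory GRing.Theory Num.Theory.

Local Open Scope classical_set_scope.
Local Open Scope ring_scope.

(** * Determinants in the plane and in the lattice *)

Definition det (R : realType) (x y : plane R) : R := x.1 * y.2 - x.2 * y.1.

Definition detz (u v : lattice) : int := u.1 * v.2 - u.2 * v.1.

Section Determinants.
Variable R : realType.
Implicit Types (x y z w : plane R) (c : R).

Lemma plane_eq x y : x.1 = y.1 -> x.2 = y.2 -> x = y.
Proof. by case: x y => [? ?] [? ?] /= -> ->. Qed.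

(* The coordinates of a point have type R^o; these rules read them in R. *)
Lemma planeD1 x y : (x + y).1 = (x.1 : R) + y.1. Proof. by []. Qed.
Lemma planeD2 x y : (x + y).2 = (x.2 : R) + y.2. Proof. by []. Qed.
Lemma planeN1 x : (- x).1 = - (x.1 : R). Proof. by []. Qed.
Lemma planeN2 x : (- x).2 = - (x.2 : R). Proof. by []. Qed.
Lemma planeZ1 c x : (c *: x).1 = c * (x.1 : R). Proof. by []. Qed.
Lemma planeZ2 c x : (c *: x).2 = c * (x.2 : R). Proof. by []. Qed.
Lemma plane01 : (0 : plane R).1 = 0 :> R. Proof. by []. Qed.
Lemma plane02 : (0 : plane R).2 = 0 :> R. Proof. by []. Qed.
Definition planeE := (planeD1, planeD2, planeN1, planeN2, planeZ1, planeZ2,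
  plane01, plane02).

Lemma detDl x y z : det (x + y) z = det x z + det y z.
Proof. by rewrite /det !planeE; ring. Qed.
Lemma detDr x y z : det z (x + y) = det z x + det z y.
Proof. by rewrite /det !planeE; ring. Qed.
Lemma detNl x z : det (- x) z = - det x z.
Proof. by rewrite /det !planeE; ring. Qed.
Lemma detNr x z : det z (- x) = - det z x.
Proof. by rewrite /det !planeE; ring. Qed.
Lemma detZl c x z : det (c *: x) z = c * det x z.
Proof. by rewrite /det !planeE; ring. Qed.
Lemma detZr c x z : det z (c *: x) = c * det z x.
Proof. by rewrite /det !planeE; ring. Qed.
Lemma det0l x : det 0 x = 0.
Proof. by rewrite /det !planeE; ring. Qed.
Lemma det0r x : det x 0 = 0.
Proof. by rewrite /det !planeE; ring. Qed.
Lemma detxx x : det x x = 0.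
Proof. by rewrite /det; ring. Qed.
Lemma detC x y : det x y = - det y x.
Proof. by rewrite /det; ring. Qed.
Definition detE :=
  (detDl, detDr, detNl, detNr, detZl, detZr, det0l, det0r, detxx).

Lemma dotDr x y w : dot w (x + y) = dot w x + dot w y.
Proof. by rewrite /dot !planeE; ring. Qed.
Lemma dotDl x y w : dot (x + y) w = dot x w + dot y w.
Proof. by rewrite /dot !planeE; ring. Qed.
Lemma dotNr x w : dot w (- x) = - dot w x.
Proof. by rewrite /dot !planeE; ring. Qed.
Lemma dotZr c x w : dot w (c *: x) = c * dot w x.
Proof. by rewrite /dot !planeE; ring. Qed.
Lemma dotZl c x w : dot (c *: w) x = c * dot w x.
Proof. by rewrite /dot !planeE; ring. Qed.
Lemma dot0r w : dot w 0 = 0.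
Proof. by rewrite /dot !planeE; ring. Qed.
Definition dotE := (dotDr, dotDl, dotNr, dotZr, dotZl, dot0r).

(** The Pluecker relation between the six minors of four plane vectors.  It
    is what transports betweenness of directions. *)
Lemma det_plucker x y z w :
  det x z * det y w = det x y * det z w + det x w * det y z.
Proof. by rewrite /det; ring. Qed.

Lemma det_cramer x y z : det x y *: z = det z y *: x + det x z *: y.
Proof. by apply: plane_eq; rewrite !planeE /det; ring. Qed.

Lemma cramer x y z : det x y != 0 ->
  z = (det z y / det x y) *: x + (det x z / det x y) *: y.
Proof.
move=> xy0; apply: (scalerI xy0); rewrite scalerDr !scalerA det_cramer.
by congr (_ *: _ + _ *: _); field.
Qed.

Lemma toRD (u v : lattice) : toR R (u + v) = toR R u + toR R v.
Proof. by apply: plane_eq; rewrite !planeE /= intrD. Qed.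

Lemma toRN (u : lattice) : toR R (- u) = - toR R u.
Proof. by apply: plane_eq; rewrite !planeE /= mulrNz. Qed.

Lemma toR0 : toR R 0 = 0.
Proof. by apply: plane_eq; rewrite !planeE. Qed.

Lemma toR_inj : injective (toR R).
Proof. by move=> [a b] [c d] [] /intr_inj -> /intr_inj ->. Qed.

Lemma det_toR (u v : lattice) : det (toR R u) (toR R v) = (detz u v)%:~R.
Proof. by rewrite /det /detz rmorphB !rmorphM. Qed.

Lemma det_toR_gt0 (u v : lattice) :
  (0 < det (toR R u) (toR R v)) = (0 < detz u v).
Proof. by rewrite det_toR ltr0z. Qed.

Lemma det_toR_eq0 (u v : lattice) :
  (det (toR R u) (toR R v) == 0) = (detz u v == 0).
Proof. by rewrite det_toR intr_eq0. Qed.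

End Determinants.

Section Lattice.
Implicit Types u v w : lattice.

Lemma lattice_eq u v : u.1 = v.1 -> u.2 = v.2 -> u = v.
Proof. by case: u v => [? ?] [? ?] /= -> ->. Qed.

Lemma latticeD1 u v : (u + v).1 = u.1 + v.1. Proof. by []. Qed.
Lemma latticeD2 u v : (u + v).2 = u.2 + v.2. Proof. by []. Qed.
Lemma latticeN1 u : (- u).1 = - u.1. Proof. by []. Qed.
Lemma latticeN2 u : (- u).2 = - u.2. Proof. by []. Qed.
Lemma latticeMn1 u m : (u *+ m).1 = u.1 *+ m.
Proof. by elim: m => // m IH; rewrite !mulrS latticeD1 IH. Qed.
Lemma latticeMn2 u m : (u *+ m).2 = u.2 *+ m.
Proof. by elim: m => // m IH; rewrite !mulrS latticeD2 IH. Qed.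
Lemma latticeZ1 u (n : int) : (u *~ n).1 = u.1 * n.
Proof.
case: n => m; first by rewrite -pmulrn latticeMn1 -mulr_natr natz.
by rewrite NegzE mulrNz latticeN1 -pmulrn latticeMn1 -mulr_natr natz mulrN.
Qed.
Lemma latticeZ2 u (n : int) : (u *~ n).2 = u.2 * n.
Proof.
case: n => m; first by rewrite -pmulrn latticeMn2 -mulr_natr natz.
by rewrite NegzE mulrNz latticeN2 -pmulrn latticeMn2 -mulr_natr natz mulrN.
Qed.
Definition latticeE :=
  (latticeD1, latticeD2, latticeN1, latticeN2, latticeZ1, latticeZ2).

Lemma detzC u v : detz u v = - detz v u.
Proof. by rewrite /detz; ring. Qed.

Lemma primitive_neq0 u : primitive u -> u != 0.
Proof. by apply: contraTneq => ->; rewrite /primitive /coprimez gcdz0. Qed.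

Lemma primitiveN u : primitive (- u) = primitive u.
Proof. by rewrite /primitive coprimezN coprimeNz. Qed.

Lemma detz1_primitive u v : detz u v = 1 -> primitive u.
Proof.
move=> uv; apply/coprimezP; exists (v.2, - v.1) => /=.
by move: uv; rewrite /detz; lia.
Qed.

Lemma mulz_eq1 (m n : int) : m * n = 1 -> m = 1 \/ m = - 1.
Proof.
move=> mn; have : (`|m| * `|n|)%N = 1%N by rewrite -abszM mn.
by move/eqP; rewrite muln_eq1 => /andP[/eqP m1 _]; lia.
Qed.

(** If Bezout's identity reads [s * u.1 + t * u.2 = 1], a vector [v] parallel to
    [u] is the integral multiple [s * v.1 + t * v.2] of it. *)
Lemma parallel_multiple u v :
  primitive u -> detz u v = 0 -> exists c, v = u *~ c.
Proof.
move=> /coprimezP[[s t] /= st] uv; exists (s * v.1 + t * v.2).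
have e : u.1 * v.2 = u.2 * v.1 by move: uv; rewrite /detz; lia.
have e1 := congr1 ( *%R^~ v.1) st; have e2 := congr1 ( *%R^~ v.2) st.
have f1 := congr1 ( *%R s) e; have f2 := congr1 ( *%R t) e.
by move: e1 e2 f1 f2 => /= *; apply: lattice_eq; rewrite !latticeE; lia.
Qed.

Lemma primitive_parallel u v : primitive u -> primitive v -> detz u v = 0 ->
  v = u \/ v = - u.
Proof.
move=> pu pv uv; have [c vE] := parallel_multiple pu uv.
have [d uE] : exists d, u = v *~ d.
  by apply: parallel_multiple; rewrite // detzC uv oppr0.
have cd : u *~ (c * d - 1) = 0.
  by rewrite mulrzBr mulrzA -vE -uE subrr.
have cd1 : c * d = 1.
  apply/eqP; rewrite -subr_eq0; apply: contraNT (primitive_neq0 pu) => /eqP n0.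
  have:= congr1 fst cd; have:= congr1 snd cd; rewrite !latticeE /=.
  by move=> f2 f1; apply/eqP/lattice_eq => /=; nia.
have [c1|c1] := mulz_eq1 cd1.
  by left; rewrite vE c1.
by right; rewrite vE c1.
Qed.

Lemma primitive_part u : u != 0 ->
  exists u' (n : nat), [/\ primitive u', (0 < n)%N & u = u' *+ n].
Proof.
move=> u0; set g := gcdz u.1 u.2.
have g0 : g != 0.
  apply: contraNneq u0 => /eqP; rewrite gcdz_eq0 => /andP[/eqP a /eqP b].
  by apply/eqP/lattice_eq.
have e1 : u.1 = (u.1 %/ g)%Z * g by rewrite divzK // dvdz_gcdl.
have e2 : u.2 = (u.2 %/ g)%Z * g by rewrite divzK // dvdz_gcdr.
exists ((u.1 %/ g)%Z, (u.2 %/ g)%Z), (gcdn `|u.1| `|u.2|); split.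
- have [s [t st]] := Bezoutz u.1 u.2.
  apply/coprimezP; exists (s, t) => /=; apply: (mulIf g0).
  by rewrite mulrDl -!mulrA -e1 -e2 st mul1r.
- by rewrite -ltz_nat lt_neqAle eq_sym g0.
- by rewrite pmulrn; apply: lattice_eq; rewrite !latticeE.
Qed.

(** The coordinates of the standard basis in a basis [u], [v] give an inverse of
    [detz u v]; when the determinant is a unit, Cramer's rule solves the system
    over the integers. *)
Lemma Zbasis_det u v : Zbasis u v <-> detz u v = 1 \/ detz u v = - 1.
Proof.
split=> [uv|].
  have [[a b] /= [e _]] := uv (1, 0); have [[c d] /= [f _]] := uv (0, 1).
  have:= congr1 fst e; have:= congr1 snd e.
  have:= congr1 fst f; have:= congr1 snd f; rewrite !latticeE /= => e4 e3 e2' e1'.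
  suff : detz u v * (a * d - b * c) = 1 by exact: mulz_eq1.
  have -> : detz u v * (a * d - b * c) =
    (u.1 * a + v.1 * b) * (u.2 * c + v.2 * d) -
    (u.1 * c + v.1 * d) * (u.2 * a + v.2 * b) by rewrite /detz; ring.
  by rewrite -e1' -e2' -e3 -e4.
wlog uv1 : u v / detz u v = 1.
  move=> H [uv|uv]; first by apply: H => //; left.
  have vu1 : detz v u = 1 by rewrite detzC uv opprK.
  move=> w; have [[a b] /= [wE wu]] := H _ _ vu1 (or_introl vu1) w.
  exists (b, a); split=> [|[c d] /= wE']; first by rewrite addrC.
  by have := wu (d, c); rewrite /= addrC => /(_ wE') [-> ->].
move=> _ w; exists (detz w v, detz u w); split=> [|[c d] /=].
  move: uv1; rewrite /detz => uv1.
  apply: lattice_eq; rewrite !latticeE /=.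
    transitivity (w.1 * (u.1 * v.2 - u.2 * v.1)); last by rewrite /detz; ring.
    by rewrite uv1 mulr1.
  transitivity (w.2 * (u.1 * v.2 - u.2 * v.1)); last by rewrite /detz; ring.
  by rewrite uv1 mulr1.
move=> ->; have cE := congr1 ( *%R c) uv1; have dE := congr1 ( *%R d) uv1.
by move: cE dE; rewrite /detz !latticeE => *; congr (_, _); lia.
Qed.

End Lattice.

(** * Rational cones and complete fans of the plane *)

Section Cones.
Variable R : realType.
Implicit Types (x y z w : plane R) (c : R) (u v r : lattice) (C D : set (plane R)).

Lemma cone_consP u s x : cone R (u :: s) x <->
  exists c y, [/\ 0 <= c, cone R s y & x = c *: toR R u + y].
Proof.
split=> [[c c0 ->]|[c [_ [c0 [d d0 ->] ->]]]].
  exists (c ord0), (\sum_i c (lift ord0 i) *: toR R s`_i); split => //.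
    by exists (fun i => c (lift ord0 i)).
  by rewrite big_ord_recl.
exists (fun i => if unlift ord0 i is Some j then d j else c) => [i|].
  by case: unliftP.
rewrite big_ord_recl /= unlift_none; congr (_ + _).
by apply: eq_bigr => i _; rewrite liftK.
Qed.

Lemma cone_nil : cone R [::] = [set 0].
Proof.
apply/seteqP; split=> [x [c _ ->]|x ->]; first by rewrite big_ord0.
by exists (fun=> 0); rewrite ?big_ord0.
Qed.

Lemma cone1P u x : cone R [:: u] x <-> exists2 c, 0 <= c & x = c *: toR R u.
Proof.
split=> [/cone_consP[c [y [c0]]]|[c c0 ->]].
  by rewrite cone_nil => -> ->; exists c; rewrite ?addr0.
by apply/cone_consP; exists c, 0; split; rewrite ?cone_nil ?addr0.
Qed.

Lemma cone2P u v x : cone R [:: u; v] x <->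
  exists a b, [/\ 0 <= a, 0 <= b & x = a *: toR R u + b *: toR R v].
Proof.
split=> [/cone_consP[a [y [a0 /cone1P[b b0 ->] ->]]]|[a [b [a0 b0 ->]]]].
  by exists a, b.
by apply/cone_consP; exists a, (b *: toR R v); split=> //; apply/cone1P; exists b.
Qed.

Lemma cone_swap u v s : cone R [:: u, v & s] = cone R [:: v, u & s].
Proof.
suff sub a b : cone R [:: a, b & s] `<=` cone R [:: b, a & s].
  by apply/seteqP; split; exact: sub.
move=> x /cone_consP[c [_ [c0 /cone_consP[d [y [d0 sy ->]]] ->]]].
apply/cone_consP; exists d, (c *: toR R a + y); rewrite addrCA; split=> //.
by apply/cone_consP; exists c, y.
Qed.

Lemma cone2C u v : cone R [:: u; v] = cone R [:: v; u].
Proof. exact: cone_swap. Qed.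

Lemma cone2_det u v x : 0 < detz u v ->
  cone R [:: u; v] x <-> 0 <= det (toR R u) x /\ 0 <= det x (toR R v).
Proof.
rewrite -(det_toR_gt0 R) => uv; split=> [/cone2P[a [b [a0 b0 ->]]]|[ux xv]].
  by rewrite !detE !mulr0 addr0 add0r !mulr_ge0 // ltW.
apply/cone2P; rewrite (cramer x (lt0r_neq0 uv)).
by do 2!eexists; split; last reflexivity; rewrite divr_ge0 // ltW.
Qed.

Lemma cone_scale s c x : 0 <= c -> cone R s x -> cone R s (c *: x).
Proof.
move=> c0 [d d0 ->]; exists (fun i => c * d i) => [i|]; first exact: mulr_ge0.
by rewrite scaler_sumr; apply: eq_bigr => i _; rewrite scalerA.
Qed.

Lemma cone_add s x y : cone R s x -> cone R s y -> cone R s (x + y).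
Proof.
move=> [c c0 ->] [d d0 ->]; exists (fun i => c i + d i) => [i|].
  exact: addr_ge0.
by rewrite -big_split; apply: eq_bigr => i _; rewrite scalerDl.
Qed.

Lemma cone0 s : cone R s 0.
Proof. by exists (fun=> 0) => //; rewrite big1 // => i _; rewrite scale0r. Qed.

Lemma cone_absorb u s : cone R s (toR R u) -> cone R (u :: s) = cone R s.
Proof.
move=> su; apply/seteqP; split=> x.
  by move=> /cone_consP[c [y [c0 sy ->]]]; apply: cone_add => //; apply: cone_scale.
by move=> sx; apply/cone_consP; exists 0, x; rewrite scale0r add0r.
Qed.

Lemma cone_congr u s t : cone R s = cone R t -> cone R (u :: s) = cone R (u :: t).
Proof.
move=> st; apply/seteqP; split=> x /cone_consP[c [y [c0 sy ->]]];
  by apply/cone_consP; exists c, y; rewrite ?st // -st.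
Qed.

Lemma cone_scale_head u s (n : nat) : (0 < n)%N ->
  cone R (u *+ n :: s) = cone R (u :: s).
Proof.
move=> n0; have nR : 0 < n%:R :> R by rewrite ltr0n.
have uE : toR R (u *+ n) = n%:R *: toR R u.
  by apply: plane_eq; rewrite !planeE /= pmulrn !latticeE rmorphM /= mulrC.
apply/seteqP; split=> x /cone_consP[c [y [c0 sy ->]]]; apply/cone_consP.
  by exists (c * n%:R), y; split; rewrite ?uE ?scalerA // mulr_ge0 // ltW.
exists (c / n%:R), y; split => //; first by rewrite divr_ge0 // ltW.
by rewrite uE scalerA divfK // gt_eqF.
Qed.

(** The possible shapes of a strongly convex rational cone of the plane. *)
Definition planar_cone C : Prop :=
  [\/ C = cone R [::],
      exists2 u, primitive u & C = cone R [:: u]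
    | exists u v, [/\ primitive u, primitive v, 0 < detz u v
                    & C = cone R [:: u; v]]].

(** A further generator [u] lies in the cone, or replaces one of its sides,
    unless [- u] lies in the cone, which strong convexity excludes. *)
Lemma planar_cone_cons u C s : primitive u -> C = cone R s -> planar_cone C ->
  strongly_convex (cone R (u :: s)) -> planar_cone (cone R (u :: s)).
Proof.
move=> pu Cs Cp sc; have u0 : toR R u <> 0.
  by rewrite -(@toR0 R) => /(@toR_inj R)/eqP; apply/negP/primitive_neq0.
have hu : cone R (u :: s) (toR R u).
  by apply/cone_consP; exists 1, 0; rewrite scale1r addr0; split => //; exact: cone0.
have nosc : ~ cone R s (- toR R u).
  move=> su; apply: u0; apply: (sc _ hu).
  by apply/cone_consP; exists 0, (- toR R u); rewrite scale0r add0r.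
case: Cp => [CE|[a pa CE]|[a [b [pa pb ab CE]]]]; rewrite {}CE in Cs.
- by apply: Or32; exists u => //; rewrite -(cone_congr _ Cs).
- rewrite -Cs in nosc; rewrite -(cone_congr _ Cs).
  case: (ltrgt0P (detz a u)) => [au|au|au].
  + by apply: Or33; exists a, u; split => //; rewrite cone2C.
  + by apply: Or33; exists u, a; split => //; rewrite detzC oppr_gt0.
  + apply: Or32; exists a => //; apply: cone_absorb; apply/cone1P; exists 1 => //.
    rewrite scale1r; case: (primitive_parallel pa pu au) => uE; rewrite uE // in nosc *.
    by case: nosc; rewrite toRN opprK; apply/cone1P; exists 1; rewrite // scale1r.
- rewrite -Cs in nosc; rewrite -(cone_congr _ Cs).
  have nn : detz a u <= 0 -> detz u b <= 0 -> False.
    move=> au ub; apply: nosc; apply/(cone2_det _ ab).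
    by rewrite !detE !oppr_ge0 !det_toR !lerz0.
  have [au|au] := leP 0 (detz a u); have [ub|ub] := leP 0 (detz u b).
  + apply: Or33; exists a, b; split => //; apply: cone_absorb.
    by apply/(cone2_det _ ab); rewrite !det_toR !ler0z.
  + have {}au : 0 < detz a u.
      by rewrite lt_neqAle au andbT; apply/eqP => au0; apply: nn; lia.
    apply: Or33; exists a, u; split => //.
    rewrite (cone_congr u (cone2C a b)) cone_swap (cone2C a); apply: cone_absorb.
    rewrite cone2C; apply/(cone2_det _ au).
    by rewrite !det_toR !ler0z (ltW ab) detzC oppr_ge0 ltW.
  + have {}ub : 0 < detz u b.
      by rewrite lt_neqAle ub andbT; apply/eqP => ub0; apply: nn; lia.
    apply: Or33; exists u, b; split => //.
    rewrite cone_swap; apply: cone_absorb; apply/(cone2_det _ ub).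
    by rewrite !det_toR !ler0z (ltW ab) detzC oppr_ge0 ltW.
  + by case: nn; exact: ltW.
Qed.

Lemma strongly_convex_sub C D : C `<=` D -> strongly_convex D -> strongly_convex C.
Proof. by move=> CD sD x /CD Dx /CD; exact: sD. Qed.

Lemma planar_coneP C : rational_cone C -> strongly_convex C -> planar_cone C.
Proof.
move=> [s ->]; elim: s => [|u s IH] sc; first exact: Or31.
have {}IH : planar_cone (cone R s).
  apply: IH; apply: strongly_convex_sub sc => x sx.
  by apply/cone_consP; exists 0, x; rewrite scale0r add0r.
have [u0|u0] := eqVneq u 0.
  by rewrite cone_absorb // u0 toR0; exact: cone0.
have [v [n [pv n0 uE]]] := primitive_part u0.
rewrite uE cone_scale_head // in sc *.
exact: planar_cone_cons IH sc.
Qed.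

Lemma ray_inj u v c : primitive u -> primitive v -> 0 < c ->
  toR R u = c *: toR R v -> u = v.
Proof.
move=> pu pv c0 uE; have /eqP : det (toR R v) (toR R u) = 0.
  by rewrite uE !detE mulr0.
rewrite det_toR_eq0 => /eqP /(primitive_parallel pv pu)[//|uN].
move: uE; rewrite uN toRN => /eqP; rewrite eq_sym -subr_eq0 opprK.
rewrite -{2}[toR R v]scale1r -scalerDl scaler_eq0 => /orP[/eqP|/eqP].
  by move=> c1; have := addr_gt0 c0 (@ltr01 R); rewrite c1 ltxx.
by rewrite -(@toR0 R) => /(@toR_inj R) v0; move: (primitive_neq0 pv); rewrite v0 eqxx.
Qed.

(** ** Fans are determined by their rays *)

Definition between u r v := (0 < detz u r) && (0 < detz r v).

(** The cones that a complete fan with set of rays [A] must have, and the only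
    ones that it can have. *)
Definition fan_of_rays (A : set lattice) : set (set (plane R)) :=
  [set C | [\/ C = cone R [::],
               exists2 u, A u & C = cone R [:: u]
             | exists u v, [/\ A u, A v, 0 < detz u v,
                 forall r, A r -> ~~ between u r v & C = cone R [:: u; v]]]].

Lemma cone2_facel u v : 0 < detz u v ->
  face_of_cone (cone R [:: u]) (cone R [:: u; v]).
Proof.
move=> uv; have dE x : dot (- (toR R u).2, (toR R u).1) x = det (toR R u) x.
  by rewrite /dot /det /=; ring.
exists (- (toR R u).2, (toR R u).1) => [x|].
  by move=> /(cone2_det _ uv)[ux _]; rewrite dE.
apply/seteqP; split=> x /=; rewrite dE.
  move=> /cone1P[c c0 ->]; rewrite !detE mulr0; split=> //.
  by apply/(cone2_det _ uv); rewrite !detE mulr0 mulr_ge0 // ltW // det_toR_gt0.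
move=> [/cone2P[a [b [a0 b0 ->]]]]; rewrite !detE mulr0 add0r => /eqP.
rewrite mulf_eq0 det_toR_eq0 (gt_eqF uv) orbF => /eqP ->.
by rewrite scale0r addr0; apply/cone1P; exists a.
Qed.

Lemma cone2_facer u v : 0 < detz u v ->
  face_of_cone (cone R [:: v]) (cone R [:: u; v]).
Proof.
move=> uv; have dE x : dot ((toR R v).2, - (toR R v).1) x = det x (toR R v).
  by rewrite /dot /det /=; ring.
exists ((toR R v).2, - (toR R v).1) => [x|].
  by move=> /(cone2_det _ uv)[_ xv]; rewrite dE.
apply/seteqP; split=> x /=; rewrite dE.
  move=> /cone1P[c c0 ->]; rewrite !detE mulr0; split=> //.
  by apply/(cone2_det _ uv); rewrite !detE mulr0 mulr_ge0 // ltW // det_toR_gt0.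
move=> [/cone2P[a [b [a0 b0 ->]]]]; rewrite !detE mulr0 addr0 => /eqP.
rewrite mulf_eq0 det_toR_eq0 (gt_eqF uv) orbF => /eqP ->.
by rewrite scale0r add0r; apply/cone1P; exists b.
Qed.

Lemma dotxx_eq0 x : (dot x x == 0) = (x == 0).
Proof.
rewrite /dot paddr_eq0 -?expr2 ?sqr_ge0 // !sqrf_eq0.
by case: x => a b.
Qed.

Lemma dotxx_ge0 x : 0 <= dot x x.
Proof. by rewrite /dot addr_ge0 // -expr2 sqr_ge0. Qed.

Lemma cone1_face0 u : u != 0 -> face_of_cone (cone R [::]) (cone R [:: u]).
Proof.
move=> u0; exists (toR R u) => [x /cone1P[c c0 ->]|].
  by rewrite dotE mulr_ge0 // dotxx_ge0.
rewrite cone_nil; apply/seteqP; split=> x /=.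
  by move=> ->; rewrite dotE; split => //; exact: cone0.
move=> [/cone1P[c c0 ->]]; rewrite dotE => /eqP; rewrite mulf_eq0 dotxx_eq0.
case/orP => [/eqP ->|]; first by rewrite scale0r.
by rewrite -(@toR0 R) (inj_eq (@toR_inj R)) (negbTE u0).
Qed.

Section CompleteFan.
Variable F : set (set (plane R)).
Hypothesis cF : complete_fan F.
Let A := ray_generators F.

Lemma fan_planar C : F C -> planar_cone C.
Proof. by case: cF => -[_ rsc _ _] _ /rsc[]; exact: planar_coneP. Qed.

Lemma fan_face C D : F C -> face_of_cone D C -> F D.
Proof. by case: cF => -[_ _ + _] _; apply. Qed.

(** A ray inside a sector of the fan would meet it in the ray itself, which is
    not a face of the sector. *)
Lemma fan_no_ray_inside u v r : 0 < detz u v -> F (cone R [:: u; v]) -> A r ->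
  ~~ between u r v.
Proof.
move=> uv Fuv [pr Fr]; apply/negP => /andP[ur rv].
have [[w w0 wE] _] : face_of_cone (cone R [:: u; v] `&` cone R [:: r]) (cone R [:: u; v])
    /\ True by split => //; case: cF => -[_ _ _ H] _; have [] := H _ _ Fuv Fr.
have Cu : cone R [:: u; v] (toR R u).
  by apply/cone2P; exists 1, 0; rewrite scale1r scale0r addr0.
have Cv : cone R [:: u; v] (toR R v).
  by apply/cone2P; exists 0, 1; rewrite scale1r scale0r add0r.
have /= [_ wr] : [set x | cone R [:: u; v] x /\ dot w x = 0] (toR R r).
  rewrite -wE; split; last by apply/cone1P; exists 1; rewrite ?scale1r.
  by apply/(cone2_det _ uv); rewrite !det_toR !ler0z !ltW.
have wu : dot w (toR R u) = 0.
  have := w0 _ Cu; have := w0 _ Cv; rewrite -(det_toR_gt0 R) in ur.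
  rewrite -(det_toR_gt0 R) in rv.
  have := congr1 (dot w) (det_cramer (toR R u) (toR R v) (toR R r)).
  by rewrite !dotE wr mulr0; nra.
have : (cone R [:: u; v] `&` cone R [:: r]) (toR R u) by rewrite wE.
case=> _ /cone1P[c c0 uE]; move: ur; rewrite -(det_toR_gt0 R) uE !detE.
by rewrite mulr0 ltxx.
Qed.

(** A vector of the open sector lies in some cone of the fan.  The rays of
    that cone are not inside the sector, nor the sides of the sector inside
    the cone, so the two are the same sector. *)
Lemma fan_sector u v : A u -> A v -> 0 < detz u v ->
  (forall r, A r -> ~~ between u r v) -> F (cone R [:: u; v]).
Proof.
move=> Au Av uv gap; case: (cF) => _ /(_ (toR R u + toR R v))[C FC].
set x := toR R u + toR R v => Cx.
have uvR : 0 < det (toR R u) (toR R v) by rewrite det_toR_gt0.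
have ux : 0 < det (toR R u) x by rewrite !detE add0r.
have xv : 0 < det x (toR R v) by rewrite !detE addr0.
have nb r : A r -> 0 < det (toR R u) (toR R r) -> 0 < det (toR R r) (toR R v) -> False.
  by rewrite !det_toR_gt0 => /gap /negP g ur rv; apply: g; rewrite /between ur.
have ray r c : A r -> 0 <= c -> x = c *: toR R r -> False.
  move=> Ar; rewrite le_eqVlt => /orP[/eqP <- xE|c0 xE].
    by rewrite xE !detE mul0r ltxx in ux.
  move: ux xv; rewrite xE !detE !pmulr_rgt0 //; exact: nb Ar.
have [CE|[r pr CE]|[p [q [pp pq pq0 CE]]]] := fan_planar FC; rewrite {}CE in FC Cx.
- by rewrite cone_nil /= in Cx; rewrite Cx !detE ltxx in ux.
- by move/cone1P: Cx => [c c0 xE]; case: (ray r c).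
have Ap : A p by split => //; apply: fan_face FC (cone2_facel pq0).
have Aq : A q by split => //; apply: fan_face FC (cone2_facer pq0).
move/cone2P: Cx => [a [b [a0 b0 xE]]].
have {}a0 : 0 < a.
  rewrite lt_neqAle a0 andbT; apply/eqP => a0'; apply: (ray q b Aq b0).
  by rewrite xE -a0' scale0r add0r.
have {}b0 : 0 < b.
  rewrite lt_neqAle b0 andbT; apply/eqP => b0'; apply: (ray p a Ap (ltW a0)).
  by rewrite xE -b0' scale0r addr0.
have pqR : 0 < det (toR R p) (toR R q) by rewrite det_toR_gt0.
have px : 0 < det (toR R p) x by rewrite xE !detE mulr0 add0r mulr_gt0.
have xq : 0 < det x (toR R q) by rewrite xE !detE mulr0 addr0 mulr_gt0.
have nb' r : A r -> 0 < det (toR R p) (toR R r) -> 0 < det (toR R r) (toR R q) -> False.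
  move=> Ar; rewrite !det_toR_gt0 => pr rq.
  by have := fan_no_ray_inside pq0 FC Ar; rewrite /between pr rq.
have up : p = u.
  have [||/eqP] := ltrgt0P (det (toR R u) (toR R p)).
  - move=> up; case: (nb p) => //.
    have := det_plucker (toR R u) (toR R p) x (toR R v); nra.
  - rewrite detC oppr_lt0 => pu; case: (nb' u) => //.
    have := det_plucker (toR R p) (toR R u) x (toR R q); nra.
  - rewrite det_toR_eq0 => /eqP /(primitive_parallel Au.1 pp)[//|pN].
    by move: px; rewrite pN toRN detNl oppr_gt0 ltNge (ltW ux).
have vq : q = v.
  have [||/eqP] := ltrgt0P (det (toR R q) (toR R v)).
  - move=> qv; case: (nb q) => //.
    have := det_plucker (toR R u) x (toR R q) (toR R v); nra.
  - rewrite detC oppr_lt0 => vq; case: (nb' v) => //.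
    have := det_plucker (toR R p) x (toR R v) (toR R q); nra.
  - rewrite det_toR_eq0 => /eqP /(primitive_parallel pq Av.1)[//|qN].
    by move: xv; rewrite qN toRN detNr oppr_gt0 ltNge (ltW xq).
by rewrite -up -vq.
Qed.

Lemma fan_origin : F (cone R [::]).
Proof.
have ray u : primitive u -> F (cone R [:: u]) -> F (cone R [::]).
  by move=> pu Fu; apply: fan_face Fu (cone1_face0 (primitive_neq0 pu)).
case: (cF) => _ /(_ 0)[C FC _].
have [<- //|[u pu CE]|[u [v [pu pv uv CE]]]] := fan_planar FC; rewrite CE in FC.
  exact: ray FC.
by apply: (ray u) => //; exact: fan_face FC (cone2_facel uv).
Qed.

Lemma complete_fanE : F = fan_of_rays A.
Proof.
apply/seteqP; split=> C.
  move=> FC; have [->|[u pu CE]|[u [v [pu pv uv CE]]]] := fan_planar FC.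
  - exact: Or31.
  - by apply: Or32; exists u => //; split; rewrite -?CE.
  - rewrite CE in FC *; apply: Or33; exists u, v; split => //.
    + by split => //; apply: fan_face FC (cone2_facel uv).
    + by split => //; apply: fan_face FC (cone2_facer uv).
    + by move=> r; exact: fan_no_ray_inside.
case=> [->|[u Au ->]|[u [v [Au Av uv gap ->]]]]; first exact: fan_origin.
  by case: Au.
exact: fan_sector.
Qed.

End CompleteFan.

Lemma complete_fan_inj (F G : set (set (plane R))) : complete_fan F -> complete_fan G ->
  ray_generators F = ray_generators G -> F = G.
Proof. by move=> cF cG FG; rewrite (complete_fanE cF) FG -complete_fanE. Qed.

End Cones.

Arguments fan_of_rays R A : clear implicits.

(** * The action of GL2(Z) *)

Section GL2.
Implicit Types (g h : 'M[int]_2) (u v : lattice) (A B : set lattice).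

Definition lattice_act g u : lattice :=
  (g 0 0 * u.1 + g 0 1 * u.2, g 1 0 * u.1 + g 1 1 * u.2).

Definition det2 g : int := g 0 0 * g 1 1 - g 0 1 * g 1 0.

Definition mx2 (a b c d : int) : 'M[int]_2 :=
  \matrix_(i, j) if i == 0 then if j == 0 then a else b
                 else if j == 0 then c else d.

Lemma lattice_act_mx2 a b c d u :
  lattice_act (mx2 a b c d) u = (a * u.1 + b * u.2, c * u.1 + d * u.2).
Proof. by rewrite /lattice_act !mxE. Qed.

Lemma mulmx2E g h i j : (g *m h) i j = g i 0 * h 0 j + g i 1 * h 1 j.
Proof. by rewrite !mxE !big_ord_recl big_ord0 addr0 /=; congr (_ + g _ _ * h _ _);
  apply: val_inj. Qed.

Lemma lattice_actM g h u : lattice_act (g *m h) u = lattice_act g (lattice_act h u).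
Proof. by apply: lattice_eq; rewrite /lattice_act !mulmx2E /=; ring. Qed.

Lemma lattice_act1 u : lattice_act 1%:M u = u.
Proof. by apply: lattice_eq; rewrite /lattice_act !mxE /=; ring. Qed.

Lemma detz_act g u v :
  detz (lattice_act g u) (lattice_act g v) = det2 g * detz u v.
Proof. by rewrite /detz /det2 /lattice_act /=; ring. Qed.

Lemma unitmx_det2 g : g \in unitmx -> det2 g = 1 \/ det2 g = - 1.
Proof.
move=> gu; apply: (@mulz_eq1 _ (det2 (invmx g))).
have <- : det2 1%:M = 1 by rewrite /det2 !mxE.
by rewrite -(mulmxV gu) /det2 !mulmx2E; ring.
Qed.

Lemma det2_unitmx a b c d : a * d - b * c = 1 \/ a * d - b * c = - 1 ->
  mx2 a b c d \in unitmx.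
Proof.
move=> D; set e := a * d - b * c in D; have ee : e * e = 1 by case: D => ->.
apply: (@mulmx1_unit _ _ _ (mx2 (e * d) (- e * b) (- e * c) (e * a)) _).1.
apply/matrixP => -[[|[|//]] ?] [[|[|//]] ?]; rewrite mulmx2E !mxE /= -?ee /e; ring.
Qed.

Definition GL2_equiv A B := exists2 g, g \in unitmx & A = lattice_act g @` B.

Lemma lattice_act_invK g A : g \in unitmx ->
  lattice_act (invmx g) @` (lattice_act g @` A) = A.
Proof.
move=> gu; rewrite image_comp -[RHS]image_id; congr (_ @` _).
by apply/funext => u /=; rewrite -lattice_actM mulVmx // lattice_act1.
Qed.

Lemma GL2_equiv_sym A B : GL2_equiv A B -> GL2_equiv B A.
Proof.
move=> [g gu ->]; exists (invmx g); first by rewrite unitmx_inv.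
by rewrite lattice_act_invK.
Qed.

Lemma GL2_equiv_trans B A C : GL2_equiv A B -> GL2_equiv B C -> GL2_equiv A C.
Proof.
move=> [g gu ->] [h hu ->]; exists (g *m h); first by rewrite unitmx_mul gu.
rewrite image_comp; congr (_ @` _).
by apply/funext => u /=; rewrite lattice_actM.
Qed.

Lemma primitive_act g u : g \in unitmx -> primitive u -> primitive (lattice_act g u).
Proof.
move=> gu /coprimezP[[s t] /= st].
have [g1|g1] := unitmx_det2 gu; move: g1; rewrite /det2 => g1;
 apply/coprimezP.
  exists (s * g 1 1 - t * g 1 0, t * g 0 0 - s * g 0 1) => /=.
  have /= h1 := congr1 ( *%R (s * u.1)) g1; have /= h2 := congr1 ( *%R (t * u.2)) g1; lia.
exists (- (s * g 1 1 - t * g 1 0), - (t * g 0 0 - s * g 0 1)) => /=.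
have /= h1 := congr1 ( *%R (s * u.1)) g1; have /= h2 := congr1 ( *%R (t * u.2)) g1; lia.
Qed.

Section Fans.
Variable R : realType.

Lemma GL2_act_toR g u : GL2_act g (toR R u) = toR R (lattice_act g u).
Proof. by apply: plane_eq; rewrite /= rmorphD !rmorphM. Qed.

Lemma GL2_act_lin g c (x y : plane R) :
  GL2_act g (c *: x + y) = c *: GL2_act g x + GL2_act g y.
Proof. by apply: plane_eq; rewrite /GL2_act !planeE /=; ring. Qed.

Lemma GL2_actM g h (x : plane R) : GL2_act (g *m h) x = GL2_act g (GL2_act h x).
Proof.
by apply: plane_eq; rewrite /GL2_act !mulmx2E /= !rmorphD !rmorphM /=; ring.
Qed.

Lemma GL2_act1 (x : plane R) : GL2_act 1%:M x = x.
Proof. by apply: plane_eq; rewrite /GL2_act !mxE /=; ring. Qed.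

Lemma GL2_act0 g : GL2_act g (0 : plane R) = 0.
Proof. by apply: plane_eq; rewrite /GL2_act !planeE /= !mulr0 addr0. Qed.

Lemma GL2_act_cone g s :
  GL2_act g (R := R) @` cone R s = cone R [seq lattice_act g u | u <- s].
Proof.
elim: s => [|u s IH] /=.
  by rewrite cone_nil image_set1 GL2_act0.
apply/seteqP; split=> x.
  move=> [_ /cone_consP[c [y [c0 sy ->]]] <-]; apply/cone_consP.
  exists c, (GL2_act g y); rewrite GL2_act_lin GL2_act_toR; split=> //.
  by rewrite -IH; exists y.
move=> /cone_consP[c [z [c0 + ->]]]; rewrite -IH => -[y sy <-].
by exists (c *: toR R u + y); rewrite ?GL2_act_lin ?GL2_act_toR //;
  apply/cone_consP; exists c, y.
Qed.

(** An element of determinant -1 exchanges the two sides of each sector. *)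
Lemma fan_of_rays_act_sub g A : g \in unitmx ->
  GL2_act_fan g (fan_of_rays R A) `<=` fan_of_rays R (lattice_act g @` A).
Proof.
move=> gu _ [C [->|[u Au ->]|[u [v [Au Av uv gap ->]]]] <-]; rewrite GL2_act_cone.
- exact: Or31.
- by apply: Or32; exists (lattice_act g u) => //; exists u.
- apply: Or33; have [g1|g1] := unitmx_det2 gu.
    exists (lattice_act g u), (lattice_act g v); split=> //.
      by rewrite detz_act g1 mul1r.
    by move=> _ [r Ar <-]; rewrite /between !detz_act g1 !mul1r; exact: gap.
  exists (lattice_act g v), (lattice_act g u); split=> //.
  - by rewrite detz_act g1 mulN1r -detzC.
  - move=> _ [r Ar <-]; rewrite /between !detz_act g1 !mulN1r -!detzC andbC.
    exact: gap.
  - exact: cone2C.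
Qed.

Lemma fan_of_rays_act g A : g \in unitmx ->
  GL2_act_fan g (fan_of_rays R A) = fan_of_rays R (lattice_act g @` A).
Proof.
move=> gu; apply/seteqP; split; first exact: fan_of_rays_act_sub.
move=> C FC; exists (GL2_act (invmx g) (R := R) @` C).
  rewrite -[A in fan_of_rays R A](lattice_act_invK A gu).
  by apply: fan_of_rays_act_sub; rewrite ?unitmx_inv //; exists C.
rewrite image_comp -[RHS]image_id; congr (_ @` _); apply/funext => x /=.
by rewrite -GL2_actM mulmxV // GL2_act1.
Qed.

End Fans.
End GL2.

(** * Convex polygons traced by their edges *)

Lemma seq_argmin d (O : orderType d) (T : eqType) (s : seq T) (f : T -> O) :
  s != [::] -> exists2 p, p \in s & forall q, q \in s -> (f p <= f q)%O.
Proof.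
elim: s => // p [_ _|q s /(_ isT)[r rs rm] _].
  by exists p; rewrite ?mem_head // => q; rewrite inE => /eqP ->.
have [pr|rp] := leP (f p) (f r).
  exists p; rewrite ?mem_head // => t; rewrite inE => /predU1P[-> //|/rm].
  exact: le_trans.
exists r; first by rewrite inE rs orbT.
by move=> t; rewrite inE => /predU1P[->|/rm //]; exact: ltW.
Qed.

Section Conv.
Variable R : realType.
Implicit Types (x y w p : plane R) (s : seq (plane R)).

Lemma dot_sum (I : finType) w (c : I -> R) (f : I -> plane R) :
  dot w (\sum_i c i *: f i) = \sum_i c i * dot w (f i).
Proof.
rewrite (big_morph (dot w) (fun x y => dotDr x y w) (dot0r w)).
by apply: eq_bigr => i _; rewrite dotE.
Qed.

Lemma conv_mem s p : p \in s -> conv s p.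
Proof.
move=> ps; have ip : (index p s < size s)%N by rewrite index_mem.
exists (fun i => (i == Ordinal ip)%:R); split=> [i||].
- exact: ler0n.
- by rewrite (bigD1 (Ordinal ip)) //= eqxx big1 ?addr0 // => i /negbTE ->.
- rewrite (bigD1 (Ordinal ip)) //= eqxx scale1r nth_index // big1 ?addr0 //.
  by move=> i /negbTE ->; rewrite scale0r.
Qed.

Lemma conv_dot_ge s w m x :
  (forall p, p \in s -> m <= dot w p) -> conv s x -> m <= dot w x.
Proof.
move=> sm [c [c0 c1 ->]]; rewrite dot_sum -[m]mul1r -c1 mulr_suml.
by apply: ler_sum => i _; apply: ler_wpM2l => //; apply: sm; rewrite mem_nth.
Qed.

Lemma conv_convex3 s (a b e : R) x y z : 0 <= a -> 0 <= b -> 0 <= e ->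
  a + b + e = 1 -> conv s x -> conv s y -> conv s z ->
  conv s (a *: x + b *: y + e *: z).
Proof.
move=> a0 b0 e0 abe [c [c0 c1 ->]] [d [d0 d1 ->]] [f [f0 f1 ->]].
exists (fun i => a * c i + b * d i + e * f i); split=> [i||].
- by rewrite !addr_ge0 // mulr_ge0.
- by rewrite !big_split -!mulr_sumr c1 d1 f1 !mulr1.
- rewrite !scaler_sumr -!big_split; apply: eq_bigr => i _ /=.
  by rewrite !scalerDl !scalerA.
Qed.

Lemma conv_convex s (a b : R) x y : 0 <= a -> 0 <= b -> a + b = 1 ->
  conv s x -> conv s y -> conv s (a *: x + b *: y).
Proof.
move=> a0 b0 ab sx sy; rewrite -[X in conv s X]addr0 -(scale0r y).
by apply: conv_convex3; rewrite ?addr0.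
Qed.

Lemma conv_translate_sub s s' t : (forall p, p \in s' -> conv s (t + p)) ->
  forall y, conv s' y -> conv s (t + y).
Proof.
move=> s'P y [c [c0 c1 ->]].
have /choice[d dP] (i : 'I_(size s')) : exists d : 'I_(size s) -> R,
    [/\ forall k, 0 <= d k, \sum_k d k = 1 & t + s'`_i = \sum_k d k *: s`_k].
  exact/s'P/mem_nth.
exists (fun k => \sum_i c i * d i k); split=> [k||].
- by apply: sumr_ge0 => i _; rewrite mulr_ge0 //; case: (dP i).
- rewrite exchange_big /= -c1; apply: eq_bigr => i _.
  by rewrite -mulr_sumr; case: (dP i) => _ -> _; rewrite mulr1.
rewrite -[t in LHS]scale1r -c1 scaler_suml -big_split /=.
under [RHS]eq_bigr do rewrite scaler_suml.
rewrite [RHS]exchange_big /=; apply: eq_bigr => i _.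
rewrite -scalerDr; case: (dP i) => _ _ ->; rewrite scaler_sumr.
by apply: eq_bigr => k _; rewrite scalerA.
Qed.

Lemma conv_min s w : s != [::] ->
  exists2 p, p \in s & forall x, conv s x -> dot w p <= dot w x.
Proof.
by move=> /(seq_argmin (dot w))[p ps pm]; exists p => // x; exact: conv_dot_ge.
Qed.

Lemma face_scale (P : set (plane R)) c w : 0 < c ->
  polygon_face P (c *: w) = polygon_face P w.
Proof.
move=> c0; apply/seteqP; split=> x [Px xm]; split=> // y /xm;
  by rewrite !dotE ler_pM2l.
Qed.

Lemma dot_eq0 x y z : det x y != 0 -> dot x z = 0 -> dot y z = 0 -> z = 0.
Proof.
move=> xy xz yz; apply: plane_eq; apply: (mulfI xy); rewrite !planeE mulr0.
  transitivity (dot x z * y.2 - dot y z * x.2 : R); first by rewrite /det /dot; ring.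
  by rewrite xz yz !mul0r subr0.
transitivity (dot y z * x.1 - dot x z * y.1 : R); first by rewrite /det /dot; ring.
by rewrite xz yz !mul0r subr0.
Qed.

End Conv.

Section Cones.
Variable R : realType.
Implicit Types (u v : lattice) (w x : plane R) (D : set (plane R)).

Lemma face_cone1 D u : face_of_cone D (cone R [:: u]) ->
  D = cone R [::] \/ D = cone R [:: u].
Proof.
move=> [w wu ->]; have /wu : cone R [:: u] (toR R u).
  by apply/cone1P; exists 1; rewrite ?scale1r.
rewrite le_eqVlt => /orP[/eqP u0|u0]; [right|left]; apply/seteqP; split=> x /=.
- by case.
- by move=> xu; split => //; case/cone1P: xu => c _ ->; rewrite dotE -u0 mulr0.
- move=> [/cone1P[c _ ->]]; rewrite dotE => /eqP.
  by rewrite mulf_eq0 (gt_eqF u0) orbF cone_nil => /eqP ->; rewrite scale0r.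
- by rewrite cone_nil => ->; split; [exact: cone0|rewrite dotE].
Qed.

Lemma face_cone2 D u v : face_of_cone D (cone R [:: u; v]) ->
  D \in [:: cone R [::]; cone R [:: u]; cone R [:: v]; cone R [:: u; v]].
Proof.
move=> [w wuv DE].
have u0 : 0 <= dot w (toR R u).
  by apply: wuv; apply/cone2P; exists 1, 0; rewrite scale1r scale0r addr0.
have v0 : 0 <= dot w (toR R v).
  by apply: wuv; apply/cone2P; exists 0, 1; rewrite scale1r scale0r add0r.
have Dx x : D x <-> exists a b, [/\ 0 <= a, 0 <= b, a * dot w (toR R u) = 0,
    b * dot w (toR R v) = 0 & x = a *: toR R u + b *: toR R v].
  rewrite DE /=; split=> [[/cone2P[a [b [a0 b0 ->]]]]|[a [b [a0 b0 au bv ->]]]].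
    rewrite !dotE => /eqP; rewrite paddr_eq0 ?mulr_ge0 // => /andP[/eqP au /eqP bv].
    by exists a, b.
  by split; [apply/cone2P; exists a, b|rewrite !dotE au bv addr0].
rewrite !inE; move: u0 v0; rewrite !le_eqVlt => /orP[/eqP u0|u0] /orP[/eqP v0|v0].
- apply/or4P/Or44/eqP/seteqP; split=> x.
    by case/Dx => a [b [a0 b0 _ _ ->]]; apply/cone2P; exists a, b.
  by case/cone2P => a [b [a0 b0 ->]]; apply/Dx; exists a, b; rewrite -u0 -v0 !mulr0.
- apply/or4P/Or42/eqP/seteqP; split=> x.
    case/Dx => a [b [a0 b0 _ /eqP + ->]]; rewrite mulf_eq0 (gt_eqF v0) orbF => /eqP ->.
    by apply/cone1P; exists a; rewrite // scale0r addr0.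
  by case/cone1P => a a0 ->; apply/Dx; exists a, 0; rewrite -u0 mulr0 mul0r scale0r addr0.
- apply/or4P/Or43/eqP/seteqP; split=> x.
    case/Dx => a [b [a0 b0 /eqP + _ ->]]; rewrite mulf_eq0 (gt_eqF u0) orbF => /eqP ->.
    by apply/cone1P; exists b; rewrite // scale0r add0r.
  by case/cone1P => a a0 ->; apply/Dx; exists 0, a; rewrite -v0 mulr0 mul0r scale0r add0r.
- apply/or4P/Or41/eqP/seteqP; split=> x; rewrite cone_nil.
    case/Dx => a [b [a0 b0 /eqP + /eqP + ->]]; rewrite !mulf_eq0.
    by rewrite (gt_eqF u0) (gt_eqF v0) !orbF => /eqP -> /eqP ->; rewrite !scale0r addr0.
  by move=> ->; apply/Dx; exists 0, 0; rewrite !mul0r !scale0r addr0.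
Qed.

End Cones.

(** The direction of an edge with inner normal [u], when the boundary is
    traced counterclockwise. *)
Definition edge_dir (R : realType) (u : plane R) : plane R := (u.2, - u.1).

(** Primitive normals in counterclockwise order, turning once around the
    origin: seen from [u j], the others come first on the left and then on the
    right. *)
Definition normal_cycle (n : nat) (u : nat -> lattice) : Prop :=
  [/\ (2 < n)%N, forall j, u (j + n)%N = u j, forall j, detz (u j) (u j.+1) = 1
    & forall j t, (0 < t)%N -> (t.+1 < n)%N ->
        detz (u j) (u (j + t)%N) <= 0 -> detz (u j) (u (j + t.+1)%N) < 0].

Definition vertex (R : realType) (u : nat -> lattice) (L : nat -> R) (j : nat) :
  plane R := \sum_(i < j) L i *: edge_dir (toR R (u i)).

Definition edge_lengths (R : realType) n (u : nat -> lattice) (L : nat -> R) : Prop :=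
  [/\ forall j, L (j + n)%N = L j, forall j, 0 < L j & vertex u L n = 0].

Section Cycle.
Variables (R : realType) (n : nat) (u : nat -> lattice) (L : nat -> R).
Hypothesis uP : normal_cycle n u.
Hypothesis LP : edge_lengths n u L.
Implicit Types (w x y : plane R) (i j k m t : nat).

Let n2 : (2 < n)%N. Proof. by case: uP. Qed.
Let u_period j : u (j + n)%N = u j. Proof. by case: uP. Qed.
Let u_det j : detz (u j) (u j.+1) = 1. Proof. by case: uP. Qed.
Let L_gt0 j : 0 < L j. Proof. by case: LP. Qed.
Let ur j : plane R := toR R (u j).
Let v := vertex u L.

Lemma dot_edge_dir w x : dot w (edge_dir x) = det w x.
Proof. by rewrite /dot /det /=; ring. Qed.

Lemma det_edge_dir w x : det (edge_dir w) x = dot w x.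
Proof. by rewrite /dot /det /=; ring. Qed.

Lemma periodic_mod (T : Type) (f : nat -> T) : (forall j, f (j + n)%N = f j) ->
  forall j k, (j = k %[mod n])%N -> f j = f k.
Proof.
move=> fn; have fm m j : f (j + m * n)%N = f j.
  by elim: m => [|m IH]; rewrite ?addn0 // mulSn addnCA addnC fn.
by move=> j k jk; rewrite (divn_eq j n) (divn_eq k n) addnC fm addnC fm jk.
Qed.

Lemma cycle_shift j k : exists2 m, (m < n)%N & (j + m = k %[mod n])%N.
Proof.
exists ((k + n.-1 * j) %% n)%N; first by rewrite ltn_mod; lia.
rewrite modnDmr addnCA -mulSn prednK; last by lia.
by rewrite addnC -modnDml modnMr.
Qed.

Lemma vertexS j : v j.+1 = v j + L j *: edge_dir (ur j).
Proof. by rewrite /v /vertex big_ord_recr. Qed.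

Lemma vertex_period j : v (j + n)%N = v j.
Proof.
elim: j => [|j IH]; first by rewrite /v; case: LP => _ _ ->; rewrite /vertex big_ord0.
by rewrite addSn !vertexS IH; case: LP => -> _ _; rewrite /ur u_period.
Qed.

Lemma dot_vertexS w j : dot w (v j.+1) = dot w (v j) + L j * det w (ur j).
Proof. by rewrite vertexS !dotE dot_edge_dir. Qed.

Lemma dot_vertexD j m : dot (ur j) (v (j + m)%N) =
  dot (ur j) (v j) + \sum_(0 <= t < m) L (j + t)%N * (detz (u j) (u (j + t)%N))%:~R.
Proof.
elim: m => [|m IH]; first by rewrite addn0 big_geq ?addr0.
by rewrite addnS dot_vertexS IH big_nat_recr //= addrA det_toR.
Qed.

(** The increments of [dot (ur j)] along the boundary are first positive, then
    negative, and sum up to zero, so that its partial sums are positive. *)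
Lemma vertex_convex j m : (1 < m < n)%N -> dot (ur j) (v j) < dot (ur j) (v (j + m)%N).
Proof.
move=> /andP[m1 mn]; rewrite dot_vertexD ltrDl.
set d := fun t => L (j + t)%N * (detz (u j) (u (j + t)%N))%:~R.
have -> : \sum_(0 <= t < m) L (j + t)%N * (detz (u j) (u (j + t)%N))%:~R =
  \sum_(0 <= t < m) d t by [].
have turn t : (0 < t)%N -> (t.+1 < n)%N -> d t <= 0 -> d t.+1 < 0.
  rewrite /d pmulr_rle0 // pmulr_rlt0 // lerz0 ltrz0.
  by case: uP => _ _ _; apply.
have neg t k : (0 < t)%N -> (t < k < n)%N -> d t <= 0 -> d k < 0.
  move=> t0; elim: k => // k IH /andP[]; rewrite ltnS leq_eqVlt.
  move=> /predU1P[tk|tk] kn dt; first by rewrite -tk in kn *; exact: turn.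
  by apply: turn => //; [exact: ltn_trans t0 tk|rewrite ltW // IH // tk ltnW].
have d0 : d 0%N = 0.
  by rewrite /d addn0 (_ : detz _ _ = 0) ?mulr0 // /detz; ring.
have d1 : 0 < d 1%N by rewrite /d addn1 u_det mulr1.
have [pos|] := boolP [forall t : 'I_m, (0 < t)%N ==> (0 < d t)].
  rewrite big_ltn ?(ltn_trans _ m1) // d0 add0r big_ltn //.
  rewrite ltr_wpDr // big_seq; apply: sumr_ge0 => t.
  rewrite mem_index_iota => /andP[t2 tm].
  by have /forallP/(_ (Ordinal tm))/implyP/(_ (ltnW t2)) := pos; exact: ltW.
rewrite negb_forall => /existsP[t]; rewrite negb_imply -leNgt => /andP[t0 dt].
have : \sum_(0 <= t < n) d t = 0.
  by apply: (addrI (dot (ur j) (v j))); rewrite addr0 -dot_vertexD vertex_period.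
rewrite (@big_cat_nat _ _ _ m) //=; last exact: ltnW.
move/eqP; rewrite addr_eq0 => /eqP ->; rewrite oppr_gt0 big_ltn //.
have dm : d m < 0 by apply: (neg t) => //; rewrite ltn_ord.
rewrite (le_lt_trans _ dm) // gerDl big_seq; apply: sumr_le0 => k.
rewrite mem_index_iota => /andP[mk kn].
by apply/ltW/(neg t) => //; rewrite kn andbT (ltn_trans _ mk).
Qed.

Lemma dot_vertex_next j : dot (ur j) (v j.+1) = dot (ur j) (v j).
Proof. by rewrite dot_vertexS detxx mulr0 addr0. Qed.

Lemma vertex_mod j k : (j = k %[mod n])%N -> v j = v k.
Proof. by apply: periodic_mod; exact: vertex_period. Qed.

Lemma u_mod j k : (j = k %[mod n])%N -> u j = u k.
Proof. by apply: periodic_mod; exact: u_period. Qed.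

Lemma vertex_ge j k : dot (ur j) (v j) <= dot (ur j) (v k).
Proof.
have [m mn /vertex_mod <-] := cycle_shift j k.
case: m mn => [|[|m]] mn; first by rewrite addn0.
  by rewrite addn1 dot_vertex_next.
by rewrite ltW // vertex_convex.
Qed.

Lemma vertex_minimal j k : dot (ur j) (v k) <= dot (ur j) (v j) ->
  (k = j %[mod n])%N \/ (k = j.+1 %[mod n])%N.
Proof.
have [m mn mk] := cycle_shift j k; rewrite -(vertex_mod mk).
case: m mn mk => [|[|m]] mn mk; first by rewrite addn0 in mk; left.
  by rewrite addn1 in mk; right.
by rewrite leNgt vertex_convex.
Qed.

Definition boundary : seq (plane R) := mkseq v n.

Let P := conv boundary.

Lemma boundaryP p : p \in boundary <-> exists j, p = v j.
Proof.
split=> [/mapP[j _ ->]|[j ->]]; first by exists j.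
apply/mapP; exists (j %% n)%N; first by rewrite mem_iota add0n ltn_mod; lia.
by apply: vertex_mod; rewrite modn_mod.
Qed.

Lemma vertex_in j : P (v j).
Proof. by apply: conv_mem; apply/boundaryP; exists j. Qed.

Lemma polygon_ge w (c : R) x : (forall j, c <= dot w (v j)) -> P x -> c <= dot w x.
Proof. by move=> H; apply: conv_dot_ge => p /boundaryP[j ->]. Qed.

Lemma vertex_face j : polygon_face P (ur j) (v j).
Proof. by split; [exact: vertex_in|move=> y; apply: polygon_ge; exact: vertex_ge]. Qed.

Lemma vertex_face_next j : polygon_face P (ur j) (v j.+1).
Proof.
by split; [exact: vertex_in|move=> y; rewrite dot_vertex_next; case: (vertex_face j) => _; apply].
Qed.

(** ** The normal fan of the polygon *)

Definition normal_cone x : set (plane R) :=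
  [set w | forall y, P y -> dot w x <= dot w y].

Lemma det_u j : 0 < det (ur j) (ur j.+1).
Proof. by rewrite det_toR u_det. Qed.

Lemma normal_cone_vertex j : normal_cone (v j.+1) = cone R [:: u j; u j.+1].
Proof.
apply/seteqP; split=> w.
  move=> wN; apply/cone2_det; first by rewrite u_det.
  have := wN _ (vertex_in j); have := wN _ (vertex_in j.+2).
  rewrite !(dot_vertexS w) -/(ur j) -/(ur j.+1) (detC (ur j)).
  have := L_gt0 j; have := L_gt0 j.+1; nra.
case/cone2P => a [b [a0 b0 ->]] y Py; rewrite !dotE lerD // ler_wpM2l //.
  by case: (vertex_face_next j) => _; apply.
by case: (vertex_face j.+1) => _; apply.
Qed.

Definition midpoint x y : plane R := 2^-1 *: x + 2^-1 *: y.

Lemma midpoint_in x y : P x -> P y -> P (midpoint x y).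
Proof. by move=> Px Py; apply: conv_convex => //; rewrite ?invr_ge0 //; lra. Qed.

Lemma normal_cone_midpoint x y : P x -> P y ->
  normal_cone (midpoint x y) = normal_cone x `&` normal_cone y.
Proof.
move=> Px Py; apply/seteqP; split=> w /=.
  move=> wm; have := wm _ Px; have := wm _ Py; rewrite /midpoint !dotE => mx my.
  by split=> z /wm; rewrite /midpoint !dotE; lra.
by case=> wx wy z Pz; have := wx z Pz; have := wy z Pz; rewrite /midpoint !dotE; lra.
Qed.

Lemma normal_cone_edge j :
  normal_cone (midpoint (v j.+1) (v j.+2)) = cone R [:: u j.+1].
Proof.
rewrite normal_cone_midpoint; try exact: vertex_in.
rewrite !normal_cone_vertex; apply/seteqP; split=> w.
  case=> /cone2_det; rewrite u_det => /(_ isT)[uw wu] /cone2P[a [b [a0 b0 wE]]].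
  move: wu; rewrite wE !detE mulr0 add0r detC -/(ur j.+1) -/(ur j.+2).
  have := det_u j.+1 => d wu; have {wu}b00 : b = 0 by nra.
  by apply/cone1P; exists a; rewrite // b00 scale0r addr0.
case/cone1P => a a0 ->; split; apply/cone2P.
  by exists 0, a; rewrite scale0r add0r.
by exists a, 0; rewrite scale0r addr0.
Qed.

Definition normal_fan : set (set (plane R)) :=
  [set C | [\/ C = cone R [::], exists j, C = cone R [:: u j]
             | exists j, C = cone R [:: u j; u j.+1]]].

Lemma normal_fan_cone C : normal_fan C -> exists2 x, P x & C = normal_cone x.
Proof.
case=> [->|[j ->]|[j ->]].
- have P12 : P (midpoint (v 1) (v 2)) by apply: midpoint_in; exact: vertex_in.
  have P23 : P (midpoint (v 2) (v 3)) by apply: midpoint_in; exact: vertex_in.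
  exists (midpoint (midpoint (v 1) (v 2)) (midpoint (v 2) (v 3))).
    exact: midpoint_in.
  rewrite normal_cone_midpoint // !normal_cone_edge cone_nil.
  apply/seteqP; split=> [x ->|x]; first by split; exact: cone0.
  case=> /cone1P[a a0 xE] /cone1P[b b0 xE'].
  have : a * det (ur 1) (ur 2) = 0 by rewrite -detZl -/(ur _) -xE xE' !detE mulr0.
  move/eqP; rewrite mulf_eq0 (gt_eqF (det_u 1)) orbF => /eqP a00.
  by rewrite /= xE a00 scale0r.
- exists (midpoint (v (j + n.-1).+1) (v (j + n.-1).+2)).
    by apply: midpoint_in; exact: vertex_in.
  rewrite normal_cone_edge -addnS prednK ?u_period //; lia.
- by exists (v j.+1); [exact: vertex_in|rewrite normal_cone_vertex].
Qed.

(** A linear form is minimal over the polygon at a vertex, and so belongs to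
    the normal cone of that vertex. *)
Lemma sector_cover w : exists j, cone R [:: u j; u j.+1] w.
Proof.
have [|p /boundaryP[j ->] jm] := @conv_min _ boundary w.
  by rewrite -size_eq0 size_mkseq; lia.
exists (j + n.-1)%N; rewrite -normal_cone_vertex -addnS prednK; last by lia.
by rewrite vertex_period.
Qed.

Lemma sector_not_line j x :
  cone R [:: u j; u j.+1] x -> cone R [:: u j; u j.+1] (- x) -> x = 0.
Proof.
have d := det_u j.
have uj : 0 < detz (u j) (u j.+1) by rewrite u_det.
move=> /(cone2_det _ uj) + /(cone2_det _ uj); rewrite !detE => -[ux xu] [uNx xNu].
have ux0 : det (ur j) x = 0 by rewrite /ur; lra.
have xu0 : det x (ur j.+1) = 0 by rewrite /ur; lra.
by rewrite (cramer x (lt0r_neq0 d)) ux0 xu0 !mul0r !scale0r addr0.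
Qed.

Lemma ray_in_sector j : cone R [:: u j] `<=` cone R [:: u j; u j.+1].
Proof.
by move=> x /cone1P[a a0 ->]; apply/cone2P; exists a, 0; rewrite scale0r addr0.
Qed.

(** Each cone of [normal_fan] is the normal cone of a point of the polygon, and
    that of [x] meets that of [y] in its face cut out by the form [y - x], which
    is nonnegative on it. *)
Lemma normal_fan_fan : fan normal_fan.
Proof.
split.
- apply: (@sub_finite_set _ _ ([set cone R [::]] `|`
    ((fun j => cone R [:: u j]) @` `I_n `|`
     (fun j => cone R [:: u j; u j.+1]) @` `I_n))).
    have jn j : `I_n (j %% n)%N by rewrite /= ltn_mod; lia.
    move=> C [->|[j ->]|[j ->]]; [by left|right; left|right; right];
      exists (j %% n)%N => //.
      by rewrite (@u_mod (j %% n) j) ?modn_mod.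
    rewrite (@u_mod (j %% n) j) ?modn_mod // (@u_mod (j %% n).+1 j.+1) //.
    by rewrite -addn1 modnDml addn1.
  by rewrite !finite_setU; split=> //; split; exact: finite_image.
- move=> C FC; split.
    by case: FC => [->|[j ->]|[j ->]]; eexists; reflexivity.
  move=> x; case: FC => [->|[j ->]|[j ->]]; last exact: sector_not_line.
    by rewrite cone_nil.
  by move=> /(@ray_in_sector j) + /(@ray_in_sector j); exact: sector_not_line.
- move=> C D [->|[j ->]|[j ->]].
  + move=> [w _ ->]; apply: Or31; rewrite cone_nil; apply/seteqP; split=> x /=.
      by case.
    by move=> ->; rewrite dot0r.
  + by case/face_cone1 => ->; [apply: Or31|apply: Or32; exists j].
  + move/face_cone2; rewrite !inE => /or4P[]/eqP ->; first exact: Or31.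
    * by apply: Or32; exists j.
    * by apply: Or32; exists j.+1.
    * by apply: Or33; exists j.
- move=> C D /normal_fan_cone[x Px ->] /normal_fan_cone[y Py ->]; split.
    exists (y - x) => [w /(_ _ Py)|]; first by rewrite /dot !planeE; lra.
    have dE w : dot (y - x) w = dot w y - dot w x by rewrite /dot !planeE; ring.
    apply/seteqP; split=> w /=; rewrite dE.
      by case=> wx wy; split=> //; apply/eqP; rewrite subr_eq0 eq_le wx // wy.
    by case=> wx /subr0_eq wE; split => // z Pz; rewrite wE wx.
  exists (x - y) => [w /(_ _ Px)|]; first by rewrite /dot !planeE; lra.
  have dE w : dot (x - y) w = dot w x - dot w y by rewrite /dot !planeE; ring.
  apply/seteqP; split=> w /=; rewrite dE.
    by case=> wx wy; split=> //; apply/eqP; rewrite subr_eq0 eq_le wx // wy.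
  by case=> wx /subr0_eq wE; split => // z Pz; rewrite wE wx.
Qed.

Lemma normal_fan_complete : complete_fan normal_fan.
Proof.
split; first exact: normal_fan_fan.
move=> w; have [j jw] := sector_cover w; exists (cone R [:: u j; u j.+1]) => //.
by apply: Or33; exists j.
Qed.

Lemma u_primitive j : primitive (u j).
Proof. exact: detz1_primitive (u_det j). Qed.

Lemma normal_fan_rays : ray_generators normal_fan = range u.
Proof.
apply/seteqP; split=> [r [pr]|_ [j _ <-]]; last first.
  by split; [exact: u_primitive|apply: Or32; exists j].
have rr : cone R [:: r] (toR R r) by apply/cone1P; exists 1; rewrite ?scale1r.
have r0 : toR R r <> 0.
  by rewrite -(@toR0 R) => /(@toR_inj R)/eqP; apply/negP/primitive_neq0.
case=> [rE|[j rE]|[j rE]].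
- by case: r0; rewrite rE cone_nil in rr.
- rewrite rE in rr; case/cone1P: rr => a; rewrite le_eqVlt => /predU1P[<- rE'|a0 rE'].
    by case: r0; rewrite rE' scale0r.
  by exists j => //; rewrite (ray_inj pr (u_primitive j) a0 rE').
- have : cone R [:: r] (ur j).
    by rewrite rE; apply/cone2P; exists 1, 0; rewrite scale1r scale0r addr0.
  have : cone R [:: r] (ur j.+1).
    by rewrite rE; apply/cone2P; exists 0, 1; rewrite scale1r scale0r add0r.
  move=> /cone1P[a a0 uE] /cone1P[b b0 uE'].
  by have := det_u j; rewrite uE uE' !detE !mulr0 ltxx.
Qed.

Lemma no_normal_between j r : range u r -> ~~ between (u j) r (u j.+1).
Proof.
rewrite -normal_fan_rays; apply: (fan_no_ray_inside normal_fan_complete).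
  by rewrite u_det.
by apply: Or33; exists j.
Qed.

(** Two rays spanning a cone of the fan have no ray between them, and neither
    lies inside the sector which that cone is, so they are its two sides. *)
Lemma normal_fan_smooth : smooth_fan normal_fan.
Proof.
have cF := normal_fan_complete.
suff pos a b : ray_generators normal_fan a -> ray_generators normal_fan b ->
    0 < detz a b -> normal_fan (cone R [:: a; b]) -> detz a b = 1.
  move=> a b [Aa Ab ab Fab]; apply/Zbasis_det.
  have [d|d|d] := ltrgt0P (detz a b).
  - by left; apply: pos.
  - right; have d' : 0 < detz b a by rewrite detzC oppr_gt0.
    by rewrite detzC pos // cone2C.
  - have [//|bE] := primitive_parallel Aa.1 Ab.1 d.
      by move=> ba; case: ab.
    have aa : cone R [:: a; b] (toR R a).
      by apply/cone2P; exists 1, 0; rewrite scale1r scale0r addr0.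
    have ba : cone R [:: a; b] (- toR R a).
      by rewrite -toRN -bE; apply/cone2P; exists 0, 1; rewrite scale1r scale0r add0r.
    case: cF => -[_ /(_ _ Fab)[_ /(_ _ aa ba) + ] _ _] _.
    by rewrite -(@toR0 R) => /(@toR_inj R) a0; have := primitive_neq0 Aa.1; rewrite a0 eqxx.
move=> Aa Ab ab Fab.
have aa : cone R [:: a; b] (toR R a).
  by apply/cone2P; exists 1, 0; rewrite scale1r scale0r addr0.
have bb : cone R [:: a; b] (toR R b).
  by apply/cone2P; exists 0, 1; rewrite scale1r scale0r add0r.
have abR : 0 < det (toR R a) (toR R b) by rewrite det_toR_gt0.
case: (Fab) => [E|[j E]|[j E]]; rewrite E in aa bb.
- by move: aa; rewrite cone_nil /= => a0; rewrite a0 det0l ltxx in abR.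
- case/cone1P: aa => x _ aE; case/cone1P: bb => y _ bE.
  by rewrite aE bE !detE !mulr0 ltxx in abR.
have side r : ray_generators normal_fan r -> cone R [:: u j; u j.+1] (toR R r) ->
    r = u j \/ r = u j.+1.
  move=> Ar /cone2P[x [y [x0 y0 rE]]].
  have := no_normal_between j; rewrite -normal_fan_rays => /(_ _ Ar).
  rewrite /between -!(det_toR_gt0 R) rE !detE mulr0 add0r mulr0 addr0.
  rewrite !pmulr_lgt0 ?det_u // negb_and -!leNgt => /orP[y0'|x0'].
    have y00 : y = 0 by apply/eqP; rewrite eq_le y0 y0'.
    left; apply: (@ray_inj R _ _ x) => //; [exact: Ar.1|exact: u_primitive| |].
    - rewrite lt_neqAle x0 andbT; apply/eqP => x00; have := primitive_neq0 Ar.1.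
      by rewrite -(inj_eq (@toR_inj R)) rE y00 -x00 !scale0r addr0 toR0 eqxx.
    - by rewrite rE y00 scale0r addr0.
  have x00 : x = 0 by apply/eqP; rewrite eq_le x0 x0'.
  right; apply: (@ray_inj R _ _ y) => //; [exact: Ar.1|exact: u_primitive| |].
  - rewrite lt_neqAle y0 andbT; apply/eqP => y00; have := primitive_neq0 Ar.1.
    by rewrite -(inj_eq (@toR_inj R)) rE x00 -y00 !scale0r addr0 toR0 eqxx.
  - by rewrite rE x00 scale0r add0r.
move: ab; case: (side _ Aa aa) => ->; case: (side _ Ab bb) => ->.
- by rewrite /detz mulrC subrr.
- by rewrite u_det.
- by rewrite detzC u_det.
- by rewrite /detz mulrC subrr.
Qed.

(** ** Edges and inner normals of the polygon *)

Lemma polygon_conv : polygon P.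
Proof.
split; first by exists boundary.
exists (v 0), (v 1), (v 2); split; try exact: vertex_in.
have -> : ((v 1).1 - (v 0).1) * ((v 2).2 - (v 0).2) -
  ((v 1).2 - (v 0).2) * ((v 2).1 - (v 0).1) = det (v 1 - v 0) (v 2 - v 0) :> R.
  by rewrite /det !planeE.
rewrite vertexS addrAC subrr add0r detZl det_edge_dir dotDr dotNr.
by rewrite mulf_neq0 ?gt_eqF // subr_gt0; apply: (@vertex_convex 0 2).
Qed.

Lemma vertexS_neq j : v j <> v j.+1.
Proof.
move=> vE; have := dot_vertexS (ur j.+1) j; rewrite -vE => /eqP.
rewrite -subr_eq0 opprD addrA subrr add0r oppr_eq0 mulf_eq0 gt_eqF //=.
by rewrite detC oppr_eq0 gt_eqF // det_u.
Qed.

Lemma inner_normalP w :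
  is_inner_normal P w <-> exists j c, 0 < c /\ w = c *: ur j.
Proof.
split=> [[w0 [x [y [xw yw xy]]]]|[j [c [c0 ->]]]]; last first.
  split.
    apply/eqP; rewrite scaler_eq0 gt_eqF //= -(@toR0 R) (inj_eq (@toR_inj R)).
    exact/primitive_neq0/u_primitive.
  rewrite face_scale //; exists (v j), (v j.+1).
  by split; [exact: vertex_face|exact: vertex_face_next|exact: vertexS_neq].
have [j /cone2P[a [b [a0 b0 wE]]]] := sector_cover w.
move: a0 b0; rewrite !le_eqVlt => /predU1P[a0|a0] /predU1P[b0|b0].
- by case: w0; rewrite wE -a0 -b0 !scale0r addr0.
- by exists j.+1, b; rewrite wE -a0 scale0r add0r.
- by exists j, a; rewrite wE -b0 scale0r addr0.
(* A form in the open sector is minimal only at the common vertex of the two edges *)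
case: xy; suff unique z : polygon_face P w z -> z = v j.+1 by rewrite (unique _ xw) (unique _ yw).
case=> Pz /(_ _ (vertex_in j.+1)); rewrite wE !dotE => zm.
have z1 := (vertex_face_next j).2 _ Pz; have z2 := (vertex_face j.+1).2 _ Pz.
apply/eqP; rewrite -subr_eq0; apply/eqP/(dot_eq0 (lt0r_neq0 (det_u j))).
  by rewrite !dotE; move: zm z1 z2; rewrite /ur; nra.
by rewrite !dotE; move: zm z1 z2; rewrite /ur; nra.
Qed.

Lemma primitive_normals : primitive_normal P = range u.
Proof.
apply/seteqP; split=> [r [pr /inner_normalP[j [c [c0 rE]]]]|_ [j _ <-]].
  by exists j => //; rewrite (ray_inj pr (u_primitive j) c0 rE).
by split; [exact: u_primitive|apply/inner_normalP; exists j, 1; rewrite scale1r].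
Qed.

Lemma rational_normals_conv : rational_normals P.
Proof.
move=> w /inner_normalP[j [c [c0 ->]]]; exists (u j), c; split=> //.
exact: u_primitive.
Qed.

(** The sum of two forms with a common minimal point has a minimum at a vertex,
    which is then minimal for both, hence an end of both edges. *)
Lemma adjacent_edges j k x : polygon_face P (ur j) x -> polygon_face P (ur k) x ->
  [\/ (j = k %[mod n])%N, (k = j.+1 %[mod n])%N | (j = k.+1 %[mod n])%N].
Proof.
move=> [Px xj] [_ xk].
have [|p /boundaryP[i ->] /(_ _ Px)] := @conv_min _ boundary (ur j + ur k).
  by rewrite -size_eq0 size_mkseq; lia.
rewrite !dotE => ix.
have ij : dot (ur j) (v i) <= dot (ur j) (v j).
  have := xj _ (vertex_in j); have := xk _ (vertex_in i); lra.
have ik : dot (ur k) (v i) <= dot (ur k) (v k).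
  have := xk _ (vertex_in k); have := xj _ (vertex_in i); lra.
case: (vertex_minimal ij) => ij'; case: (vertex_minimal ik) => ik'.
- by apply: Or31; rewrite -ij'.
- by apply: Or33; rewrite -ij'.
- by apply: Or32; rewrite -ik'.
- apply: Or31; apply/eqP; rewrite -(eqn_modDr 1) !addn1 -ij' ik'.
  exact/eqP.
Qed.

Lemma delzant_conv : delzant P.
Proof.
split; [exact: polygon_conv|exact: rational_normals_conv|].
move=> a b; rewrite primitive_normals => -[j _ <-] [k _ <-] jk [x [xj xk]].
apply/Zbasis_det; have [/u_mod //|/u_mod kE|/u_mod jE] := adjacent_edges xj xk.
  by left; rewrite kE u_det.
by right; rewrite jE detzC u_det.
Qed.

Lemma edges_card : (edges P #= `I_n)%card.
Proof.
have -> : edges P = (fun j => polygon_face P (ur j)) @` `I_n.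
  apply/seteqP; split=> [_ [w /inner_normalP[j [c [c0 ->]]] <-]|_ [j _ <-]].
    exists (j %% n)%N; first by rewrite /= ltn_mod; lia.
    by rewrite face_scale // /ur (@u_mod (j %% n) j) ?modn_mod.
  by exists (ur j) => //; apply/inner_normalP; exists j, 1; rewrite scale1r.
apply: inj_card_eq => j k; rewrite !inE /= => jn kn jk.
have fk := vertex_face k; have fk' := vertex_face_next k; rewrite -jk in fk fk'.
case: (vertex_minimal (fk.2 _ (vertex_in j))); first by rewrite !modn_small.
move=> kj; case: (vertex_minimal (fk'.2 _ (vertex_in j))) => /eqP.
  rewrite -addn1 -modnDml kj modnDml addn1 -addn2 -[X in _ == X %[mod _]]addn0.
  by rewrite eqn_modDl !modn_small //; lia.
by rewrite -addn1 -[j.+1]addn1 eqn_modDr !modn_small // => /eqP.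
Qed.

Lemma octagon_conv : n = 8%N -> octagon P.
Proof. by move=> n8; split; [exact: polygon_conv|rewrite -n8; exact: edges_card]. Qed.

Lemma normal_fan_of_polygon : has_inner_normal_fan P normal_fan.
Proof.
split; [exact: polygon_conv|exact: rational_normals_conv| |].
  exact: normal_fan_complete.
by rewrite normal_fan_rays primitive_normals.
Qed.

(** Every point on the inner side of all the edges lies in one of the
    triangles cut by the diagonals from the vertex 0: between the first and the
    last diagonal, [det (v j) x] changes sign. *)
Lemma halfplanes_in x : (forall j, dot (ur j) (v j) <= dot (ur j) x) -> P x.
Proof.
move=> xge; have v0 : v 0 = 0 by rewrite /v /vertex big_ord0.
have g1 : 0 <= det (v 1) x.
  rewrite vertexS v0 add0r detZl det_edge_dir mulr_ge0 ?(ltW (L_gt0 _)) //.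
  by have := xge 0%N; rewrite v0 dot0r.
have gn : det (v n.-1) x <= 0.
  have vn : v n = 0 by have := vertex_period 0; rewrite add0n v0.
  have := vertexS n.-1; rewrite prednK ?vn; last by lia.
  move/esym/eqP; rewrite addr_eq0 => /eqP ->.
  rewrite detNl detZl det_edge_dir oppr_le0.
  have := xge n.-1; rewrite -dot_vertex_next prednK ?vn ?dot0r; last by lia.
  by move=> ?; rewrite mulr_ge0 // ltW.
have /ex_minnP[j /andP[j1 gj] jmin] : exists j, (0 < j)%N && (det (v j.+1) x <= 0).
  by exists n.-2; rewrite prednK ?gn ?andbT; lia.
have jn : (j < n.-1)%N.
  rewrite ltnNge; apply/negP => nj; have := jmin n.-2.
  by rewrite prednK ?gn ?andbT; lia.
have {}gj0 : 0 <= det (v j) x.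
  case: j j1 {gj jn} jmin => // -[_ _ //|j] _ /(_ j.+1); rewrite /=.
  by rewrite ltnn; case: (leP (det (v j.+2) x) 0) => [_ /(_ isT)|/ltW].
set h := - dot (ur j) (v j).
have h0 : 0 < h.
  rewrite oppr_gt0 -(dot0r (ur j)) -v0 -(vertex_period 0) add0n.
  have nE : n = (j + (n - j))%N by lia.
  by rewrite [in X in _ < X]nE vertex_convex //; lia.
have A0 : 0 < det (v j) (v j.+1).
  by rewrite vertexS detDr detxx add0r detZr detC det_edge_dir mulr_gt0.
set al := det x (v j.+1) / det (v j) (v j.+1).
set be := det (v j) x / det (v j) (v j.+1).
have xE : x = al *: v j + be *: v j.+1 by apply: cramer; rewrite gt_eqF.
have al0 : 0 <= al by rewrite divr_ge0 ?(ltW A0) // detC oppr_ge0.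
have be0 : 0 <= be by rewrite divr_ge0 // ltW.
have ab1 : al + be <= 1.
  have := xge j; rewrite [in X in _ <= X]xE !dotE dot_vertex_next.
  by rewrite -mulrDl -[dot _ _]opprK -/h mulrN lerN2 -{2}[h]mul1r ler_pM2r.
rewrite xE -[X in P X]addr0 -(scaler0 _ (1 - (al + be))) -v0.
apply: conv_convex3 => //; try exact: vertex_in.
  by rewrite subr_ge0.
by rewrite addrC subrK.
Qed.

End Cycle.

Arguments normal_fan R u : clear implicits.

(** * A polygon is traced by its edges *)

Section Reconstruct.
Variables (R : realType) (n : nat) (u : nat -> lattice).
Hypothesis uP : normal_cycle n u.
Hypothesis gap : forall j r, range u r -> ~~ between (u j) r (u j.+1).
Variables (P : set (plane R)) (s : seq (plane R)).
Hypothesis Ps : P = conv s.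
Hypothesis P0 : P !=set0.
Hypothesis normalsP : primitive_normal P = range u.
Hypothesis rationalP : rational_normals P.
Implicit Types (w x y p : plane R) (j : nat).

Let ur j : plane R := toR R (u j).
Let u_period j : u (j + n)%N = u j. Proof. by case: uP. Qed.

Let det_u j : 0 < det (ur j) (ur j.+1).
Proof. by rewrite det_toR; case: uP => _ _ -> _. Qed.

Let s0 : s != [::].
Proof.
apply/eqP => sE; case: P0 => x; rewrite Ps sE => -[c [_ /eqP]].
by rewrite big_ord0 eq_sym oner_eq0.
Qed.

Definition face_end w p := polygon_face P w p /\
  forall x, polygon_face P w x -> dot (edge_dir w) x <= dot (edge_dir w) p.

(** A point of the face is a convex combination of the generators that lie on
    the face, so one of these is extreme in the direction of the face. *)
Lemma exists_face_end w : exists p, face_end w p.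
Proof.
have [p0 p0s pm0] := conv_min w s0.
pose s' := [seq q <- s | dot w q == dot w p0].
have s'0 : s' != [::].
  apply/eqP => E; have : p0 \in s' by rewrite mem_filter eqxx.
  by rewrite E.
have [p ps' pm] := seq_argmin (fun q => - dot (edge_dir w) q) s'0.
move: (ps'); rewrite mem_filter => /andP[/eqP pE ps].
exists p; split.
  by split=> [|y]; rewrite Ps ?pE; [exact: conv_mem|exact: pm0].
move=> x [+ xm]; rewrite {1}Ps => -[c [c0 c1 xE]].
have wx : \sum_i c i * (dot w s`_i - dot w p0) = 0.
  under eq_bigr do rewrite mulrBr.
  rewrite sumrB -mulr_suml c1 mul1r -dot_sum -xE; apply/eqP.
  rewrite subr_eq0 eq_le -{1}pE xm /=; last by rewrite Ps; exact: conv_mem.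
  by apply: pm0; exists c.
have si (i : 'I_(size s)) : s`_i \in s by exact: mem_nth.
have c00 i : c i * (dot w s`_i - dot w p0) = 0.
  apply: (psumr_eq0P _ wx) => // k _; rewrite mulr_ge0 // subr_ge0.
  exact/pm0/conv_mem.
rewrite xE dot_sum -[dot _ p]mul1r -c1 mulr_suml; apply: ler_sum => i _.
have /eqP := c00 i; rewrite mulf_eq0 subr_eq0 => /orP[/eqP ->|sE].
  by rewrite !mul0r.
by rewrite ler_wpM2l // -lerN2; apply: pm; rewrite mem_filter sE si.
Qed.

Lemma dot_frame w x y : dot w w * dot x y =
  dot x w * dot w y + det x w * dot (edge_dir w) y.
Proof. by rewrite /dot /det /edge_dir /=; ring. Qed.

Lemma frame w y : dot w w *: y = dot w y *: w + dot (edge_dir w) y *: edge_dir w.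
Proof. by apply: plane_eq; rewrite !planeE /dot /edge_dir /=; ring. Qed.

Lemma dot_ur_gt0 j : 0 < dot (ur j) (ur j).
Proof.
rewrite lt_neqAle dotxx_ge0 andbT eq_sym dotxx_eq0.
by apply/eqP => u0; have := det_u j; rewrite u0 det0l ltxx.
Qed.

(** If the end [p] of the edge with normal [u j] did not lie on the next edge,
    then turning the normal from [ur j] towards [ur j.+1] one would meet a
    first form which [p] shares with another point of the polygon as a
    minimum: it would be an inner normal between [u j] and [u j.+1]. *)
Lemma face_end_next j p : face_end (ur j) p -> polygon_face P (ur j.+1) p.
Proof.
move=> [[Pp pm] pend]; split=> // y Py; rewrite leNgt; apply/negP => yp.
pose t := [seq q <- s | dot (ur j.+1) q < dot (ur j.+1) p].
have sP q : q \in s -> P q by rewrite Ps; exact: conv_mem.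
have t0 : t != [::].
  have [q qs qm] := conv_min (ur j.+1) s0.
  apply/eqP => E; have : q \in t; last by rewrite E.
  by rewrite mem_filter qs andbT (le_lt_trans _ yp) // qm // -Ps.
pose rho q := (dot (ur j) q - dot (ur j) p) / (dot (ur j.+1) p - dot (ur j.+1) q).
have [z + zm] := seq_argmin rho t0; rewrite mem_filter => /andP[zp zs].
have den : 0 < dot (ur j.+1) p - dot (ur j.+1) z by rewrite subr_gt0.
have num : 0 < dot (ur j) z - dot (ur j) p.
  rewrite subr_gt0 lt_neqAle pm ?andbT; last exact: sP.
  apply/eqP => pz; have zf : polygon_face P (ur j) z.
    by split=> [|q]; [exact: sP|rewrite -pz; exact: pm].
  have ze := pend _ zf.
  have := dot_frame (ur j) (ur j.+1) (z - p); rewrite [det _ (ur j)]detC.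
  rewrite !(dotDr, dotNr) -pz subrr mulr0 add0r.
  by have := dot_ur_gt0 j; have := det_u j; move: ze zp; nra.
have rho0 : 0 < rho z by rewrite divr_gt0.
pose w := ur j + rho z *: ur j.+1.
have uw : 0 < det (ur j) w by rewrite !detE add0r mulr_gt0.
have wu : 0 < det w (ur j.+1) by rewrite !detE mulr0 addr0.
have wp q : q \in s -> dot w p <= dot w q.
  move=> qs; rewrite !dotE; have pq := pm _ (sP _ qs).
  have [qp|qp] := ltP (dot (ur j.+1) q) (dot (ur j.+1) p).
    have /zm : q \in t by rewrite mem_filter qp.
    rewrite /(rho q) ler_pdivlMr ?subr_gt0 //; lra.
  by rewrite lerD // ler_pM2l.
have wz : dot w z = dot w p.
  rewrite !dotE; have : rho z * (dot (ur j.+1) p - dot (ur j.+1) z) =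
    dot (ur j) z - dot (ur j) p by rewrite /rho divfK // gt_eqF.
  lra.
have pf : polygon_face P w p by split=> // x; rewrite Ps; exact: conv_dot_ge.
have wn : is_inner_normal P w.
  split; first by move=> w0; rewrite w0 det0r ltxx in uw.
  exists p, z; split => //; last by move=> pz; rewrite pz subrr ltxx in den.
  by split=> [|x /pf.2]; rewrite ?wz //; exact: sP.
have [r [c [pr c0 wE]]] := rationalP wn.
have rn : range u r.
  rewrite -normalsP; split => //; case: wn => _ [x [y' [xf yf xy]]]; split.
    by move=> r0; rewrite wE r0 scaler0 det0r ltxx in uw.
  by exists x, y'; move: xf yf; rewrite wE face_scale.
have /negP := gap j rn; apply; rewrite /between -!(det_toR_gt0 R).
by move: uw wu; rewrite wE !detE !pmulr_rgt0 // => -> ->.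
Qed.

Lemma face_ray j p q : polygon_face P (ur j) p -> polygon_face P (ur j.+1) p ->
  polygon_face P (ur j.+1) q ->
  exists2 c, 0 <= c & q = p + c *: edge_dir (ur j.+1).
Proof.
move=> [Pp pm] [_ pm'] [Pq qm].
have e0 : dot (ur j.+1) (q - p) = 0.
  by apply/eqP; rewrite dotDr dotNr subr_eq0 eq_le qm // pm'.
pose c := dot (edge_dir (ur j.+1)) (q - p) / dot (ur j.+1) (ur j.+1).
have qE : q - p = c *: edge_dir (ur j.+1).
  apply: (scalerI (lt0r_neq0 (dot_ur_gt0 j.+1))); rewrite frame e0 scale0r add0r.
  by rewrite scalerA /c mulrCA divff ?mulr1 // gt_eqF // dot_ur_gt0.
exists c; last by rewrite -qE addrC subrK.
have : 0 <= dot (ur j) (q - p) by rewrite dotDr dotNr subr_ge0 pm.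
by rewrite qE dotZr dot_edge_dir pmulr_lge0.
Qed.

(** The ends of the edges are the partial sums of the edge vectors, and return to
    the first one after [n] edges. *)
Theorem polygon_of_normals : exists (L : nat -> R) (t : plane R),
  edge_lengths n u L /\ P = translate t (conv (boundary n u L)).
Proof.
have n0 : (0 < n)%N by case: uP; lia.
have /choice[e0 e0P] j : exists p, face_end (ur j) p by exact: exists_face_end.
pose e j := e0 (j %% n)%N.
have eP j : face_end (ur j) (e j).
  by rewrite /ur (u_mod uP (k := j %% n)) ?modn_mod //; exact: e0P.
pose f j := e (j + n.-1)%N.
have fS j : f j.+1 = e j by rewrite /f addSnnS prednK // /e modnDr.
have fn j : f (j + n)%N = f j by rewrite /f /e addnAC modnDr.
have f_start j : polygon_face P (ur j) (f j).
  by have := face_end_next (eP (j + n.-1)%N); rewrite -addnS prednK // /ur u_period.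
have ray j x : polygon_face P (ur j) x ->
    exists2 c, 0 <= c & x = f j + c *: edge_dir (ur j).
  have uE : ur (j + n.-1).+1 = ur j by rewrite -addnS prednK // /ur u_period.
  by rewrite -uE; apply: face_ray; [case: (eP (j + n.-1)%N)|rewrite uE].
pose ed j := edge_dir (ur j).
have ed_ur j : dot (ed j) (ed j) = dot (ur j) (ur j).
  by rewrite /dot /ed /edge_dir /=; ring.
pose L j := dot (ed j) (f j.+1 - f j) / dot (ed j) (ed j).
have LE j c : f j.+1 = f j + c *: ed j -> L j = c.
  move=> E; rewrite /L E addrC addKr dotZr mulfK // ed_ur gt_eqF //.
  exact: dot_ur_gt0.
have fL j : f j.+1 = f j + L j *: ed j.
  have [|c _ E] := ray j (f j.+1); last by rewrite (LE _ _ E).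
  by rewrite fS; case: (eP j).
have L0 j : 0 < L j.
  have : primitive_normal P (u j) by rewrite normalsP; exists j.
  case=> _ [_ [x [y [xf yf xy]]]].
  have := (eP j).2 _ xf; have := (eP j).2 _ yf.
  have [c c0 xE] := ray _ _ xf; have [d d0 yE] := ray _ _ yf.
  rewrite -fS fL xE yE !dotDr !dotZr !lerD2l -/(ed j) !ler_pM2r ?ed_ur ?dot_ur_gt0 //.
  move=> dL cL; rewrite lt_neqAle (le_trans c0 cL) andbT; apply/eqP => L00.
  by apply: xy; rewrite xE yE; congr (_ + _ *: _); lra.
have vE j : vertex u L j = f j - f 0.
  elim: j => [|j IH]; first by rewrite /vertex big_ord0 subrr.
  by rewrite vertexS IH fL addrAC.
have LP : edge_lengths n u L.
  split=> // [j|]; last by rewrite vE -[n]add0n fn subrr.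
  by apply: LE; rewrite -addSn !fn fL /ed /ur u_period.
exists L, (f 0); split => //; apply/seteqP; split=> x.
  move=> Px; exists (x - f 0); last by rewrite addrC subrK.
  apply: (halfplanes_in uP LP) => j; rewrite vE !(dotDr, dotNr) lerD2r.
  by case: (f_start j) => _; apply.
move=> [y yB <-]; rewrite Ps; apply: (conv_translate_sub _ yB) => p.
rewrite (boundaryP uP LP) => -[j ->]; rewrite vE addrC subrK -Ps.
by case: (f_start j).
Qed.

End Reconstruct.

(** * Chains of normals in a half plane *)

Definition unidet : rel lattice := fun u v => detz u v == 1.

Definition chain (s : seq lattice) : bool :=
  path unidet e2 (rcons s (- e2)) && all (fun u => u.1 < 0) s.

Definition closed_chain (s : seq lattice) : seq lattice := e2 :: rcons s (- e2).

Section Chain.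
Implicit Types (s t : seq lattice) (u v w : lattice).

Lemma closed_chain_det s j : chain s -> (j < (size s).+1)%N ->
  detz (closed_chain s)`_j (closed_chain s)`_j.+1 = 1.
Proof.
by move=> /andP[/(pathP 0) + _] js => /(_ j); rewrite size_rcons => /(_ js)/eqP.
Qed.

Lemma closed_chain_fst_lt0 s j : chain s -> (0 < j < (size s).+1)%N ->
  ((closed_chain s)`_j).1 < 0.
Proof.
move=> /andP[_ /allP sn] /andP[]; case: j => //= j _; rewrite ltnS => js.
by rewrite nth_rcons js; apply: sn; rewrite mem_nth.
Qed.

Lemma closed_chain_fst_le0 s j : chain s -> (j < (size s).+2)%N ->
  ((closed_chain s)`_j).1 <= 0.
Proof.
move=> sc js; have [->//|j0] := posnP j.
have [js'|js'] := ltnP j (size s).+1.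
  by rewrite ltW // closed_chain_fst_lt0 // j0.
have -> : j = (size s).+1 by lia.
by rewrite /= nth_rcons ltnn eqxx.
Qed.

(** The minors of [u], [v], [w] and [e2] give
    [v.1 * detz u w = u.1 * detz v w + w.1 * detz u v]; in the half plane this
    propagates positivity from consecutive vectors to all pairs. *)
Lemma closed_chain_sorted s i j : chain s -> (i < j < (size s).+2)%N ->
  (0 < i)%N || (j < (size s).+1)%N -> 0 < detz (closed_chain s)`_i (closed_chain s)`_j.
Proof.
move=> sc; elim: j => // j IH /andP[]; rewrite ltnS leq_eqVlt => /predU1P[->|ij] js ends.
  by rewrite closed_chain_det.
have {IH} : 0 < detz (closed_chain s)`_i (closed_chain s)`_j by apply: IH; lia.
have : detz (closed_chain s)`_j (closed_chain s)`_j.+1 = 1.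
  exact: closed_chain_det.
have : ((closed_chain s)`_j).1 < 0 by apply: closed_chain_fst_lt0 => //; lia.
have : ((closed_chain s)`_i).1 <= 0 by apply: closed_chain_fst_le0 => //; lia.
have : ((closed_chain s)`_j.+1).1 <= 0 by exact: closed_chain_fst_le0.
have : ((closed_chain s)`_i).1 < 0 \/ ((closed_chain s)`_j.+1).1 < 0.
  by case/orP: ends => h; [left|right]; apply: closed_chain_fst_lt0 => //; lia.
move: (closed_chain s)`_i (closed_chain s)`_j (closed_chain s)`_j.+1 => u v w.
move=> uw w0 u0 v0 vw uv.
have : v.1 * detz u w = u.1 * detz v w + w.1 * detz u v by rewrite /detz; ring.
rewrite vw mulr1 => E; suff : v.1 * detz u w < 0 by rewrite nmulr_rlt0.
rewrite E; case: uw => [u1|w1]; first by rewrite ltr_wnDr // mulr_le0_ge0 // ltW.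
by rewrite ltr_wnDl // nmulr_rlt0.
Qed.

Lemma chain_no_inside s i m : chain s -> (m < (size s).+1)%N -> (i < (size s).+2)%N ->
  i != m -> i != m.+1 ->
  0 <= detz (closed_chain s)`_i (closed_chain s)`_m.+1 ->
  detz (closed_chain s)`_i (closed_chain s)`_m <= 0 -> False.
Proof.
move=> sc ms is_ im im1 h1 h2.
have [lt|lt] : (i < m)%N \/ (m.+1 < i)%N by lia.
  have := @closed_chain_sorted s i m sc; have -> : (i < m < (size s).+2)%N by lia.
  by rewrite ms orbT => /(_ isT isT); rewrite ltNge h2.
have := @closed_chain_sorted s m.+1 i sc; rewrite lt is_ => /(_ isT isT).
by rewrite detzC oppr_gt0 ltNge h1.
Qed.

(** By Cramer's rule, [w] is a nonnegative combination of [u] and [v]. *)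
Lemma sector_fst u v w : detz u v = 1 -> detz w u <= 0 -> 0 <= detz w v ->
  u.1 <= 0 -> v.1 <= 0 -> w.1 <= 0.
Proof.
move=> uv wu wv u0 v0; have : w.1 * detz u v = u.1 * detz w v - v.1 * detz w u.
  by rewrite /detz; ring.
rewrite uv mulr1; nia.
Qed.

Definition two_chains s t : seq lattice := e2 :: s ++ - e2 :: map -%R t.

Definition cyclic (s : seq lattice) (j : nat) : lattice := s`_(j %% size s).

Lemma size_two_chains s t : size (two_chains s t) = (size s + size t).+2.
Proof. by rewrite /= size_cat /= size_map addnS. Qed.

Lemma cyclic_period s j : cyclic s (j + size s) = cyclic s j.
Proof. by rewrite /cyclic modnDr. Qed.

Lemma cyclic_left s t j : (j < (size s).+2)%N ->
  cyclic (two_chains s t) j = (closed_chain s)`_j.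
Proof.
move=> js; rewrite /cyclic modn_small ?size_two_chains; last by lia.
case: j js => // j; rewrite !ltnS => js; rewrite /= nth_cat nth_rcons.
by case: ltngtP js => // -> _; rewrite subnn.
Qed.

Lemma cyclic_right s t j : (j < (size t).+2)%N ->
  cyclic (two_chains s t) ((size s).+1 + j) = - (closed_chain t)`_j.
Proof.
rewrite ltnS leq_eqVlt => /predU1P[->|jt].
  have -> : ((size s).+1 + (size t).+1 = 0 + size (two_chains s t))%N.
    by rewrite size_two_chains; lia.
  by rewrite cyclic_period /cyclic mod0n /= nth_rcons ltnn eqxx opprK.
rewrite /cyclic modn_small; last by rewrite size_two_chains; lia.
rewrite /= nth_cat ltnNge leq_addr /= addKn.
case: j jt => // j; rewrite ltnS => jt; rewrite /= (nth_map 0) // nth_rcons jt.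
by [].
Qed.

Lemma cyclic_mod s j k : cyclic s (j %% size s + k) = cyclic s (j + k).
Proof. by rewrite /cyclic modnDml. Qed.

Lemma detzNN u v : detz (- u) (- v) = detz u v.
Proof. by rewrite /detz !latticeE; ring. Qed.

(** A normal in the sector of two consecutive ones is in their half plane, hence
    in the same chain; but the chains are sorted. *)
Lemma two_chains_cycle s t : chain s -> chain t -> s != [::] -> t != [::] ->
  normal_cycle (size s + size t).+2 (cyclic (two_chains s t)).
Proof.
move=> sc tc; rewrite -!size_eq0 -!lt0n => s0 t0.
have [n nE] : exists n, n = (size s + size t).+2 by exists (size s + size t).+2.
rewrite -nE; set u := cyclic _.
have sz : size (two_chains s t) = n by rewrite size_two_chains.
have um j k : u (j %% n + k)%N = u (j + k)%N by rewrite -sz; exact: cyclic_mod.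
have up j : u (j + n)%N = u j by rewrite -sz; exact: cyclic_period.
have um0 j : u (j %% n)%N = u j by have := um j 0%N; rewrite !addn0.
have left j : (j < (size s).+2)%N -> u j = (closed_chain s)`_j by exact: cyclic_left.
have right j : (j < (size t).+2)%N -> u ((size s).+1 + j)%N = - (closed_chain t)`_j.
  exact: cyclic_right.
have rightE j : ((size s).+1 <= j)%N -> (j < (size s + size t).+3)%N ->
    u j = - (closed_chain t)`_(j - (size s).+1).
  by move=> j1 j2; have := right (j - (size s).+1)%N; rewrite subnKC //; apply; lia.
have det1u j : detz (u j) (u j.+1) = 1.
  rewrite -um0 -addn1 -um addn1; have : (j %% n < n)%N by rewrite ltn_mod nE.
  move: (j %% n)%N => {}j jn; have [js|js] := ltnP j (size s).+1.
    by rewrite !left ?closed_chain_det //; lia.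
  rewrite !rightE ?detzNN; try lia.
  by rewrite (subSn js) closed_chain_det //; lia.
split=> // [|j k k0 kn uk]; first by rewrite nE !ltnS addn_gt0 s0.
rewrite ltNge; apply/negP => uk1.
(* u j would be in the sector of two consecutive normals, all of one chain *)
rewrite -(um0 j) -[u (j + k)%N]um -[u (j + k.+1)%N]um in uk uk1.
have : (j %% n < n)%N by rewrite ltn_mod nE.
move: (j %% n)%N uk uk1 => {}j uk uk1 jn.
have [m [mn mE um' um1]] : exists m, [/\ (m < n)%N, m = j + k \/ m + n = j + k,
    u m = u (j + k) & u m.+1 = u (j + k.+1)]%N.
  have [jk|jk] := ltnP (j + k) n.
    by exists (j + k)%N; split => //; [left|rewrite addnS].
  exists (j + k - n)%N; split; [lia|right; lia| |].
    by rewrite -[in RHS](subnK jk) up.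
  by rewrite addnS -[in RHS](subnK jk) -addSn up.
rewrite -{}um' in uk; rewrite -{}um1 in uk1.
have [ms|ms] := ltnP m (size s).+1.
  have js : (j < (size s).+2)%N.
    rewrite ltnNge; apply/negP => js.
    have t0' : ((closed_chain t)`_(j - (size s).+1)).1 < 0.
      by apply: closed_chain_fst_lt0 => //; lia.
    have : (u j).1 <= 0.
      apply: (sector_fst (det1u m)) => //; rewrite left; try lia;
        by apply: closed_chain_fst_le0 => //; lia.
    by rewrite rightE; [rewrite latticeE oppr_le0 leNgt t0'|lia|lia].
  rewrite !left in uk uk1; try lia.
  by apply: (chain_no_inside (i := j) (m := m) sc) => //; lia.
have [i [it uj im]] : exists i, [/\ (i < (size t).+2)%N, u j = - (closed_chain t)`_i
    & i != m - (size s).+1 /\ i != (m - (size s).+1).+1]%N.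
  have [js|js] := ltnP (size s) j.
    by exists (j - (size s).+1)%N; split; rewrite ?rightE //; lia.
  have [j0|j0] := posnP j.
    exists (size t).+1; split=> //; last by lia.
    rewrite -right // j0; have -> : ((size s).+1 + (size t).+1 = 0 + n)%N by lia.
    by rewrite up.
  have : (u j).1 < 0 by rewrite left; [apply: closed_chain_fst_lt0 => //|]; lia.
  suff : (- u j).1 <= 0 by rewrite latticeE; lia.
  have := det1u m; rewrite -detzNN => /sector_fst; apply; rewrite ?detzNN //;
    rewrite rightE ?opprK; try lia; apply: closed_chain_fst_le0 => //; lia.
move: uk uk1; rewrite uj !rightE; try lia.
rewrite !detzNN subSn // => uk uk1.
apply: (chain_no_inside (i := i) (m := m - (size s).+1) tc) => //; lia.
Qed.

End Chain.

(** * The fifteen families *)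

(** The sign is chosen for [shear k] to map [(-1, 0)] to [vk k]. *)
Definition shear (k : int) (u : lattice) : lattice := (u.1, u.2 - k * u.1).

(** The left normals of [Sigma R i 0] in counterclockwise order: an edge with
    direction [(a, b)] has the normal [(- b, a)]. *)
Definition left_form (i : nat) : seq lattice :=
  [seq (- ab.2, ab.1) | ab <- zip (coef_a i 0) (coef_b i)].

(** The opposites of the right normals, which thus form a chain in the left half
    plane too. *)
Definition right_form (i : nat) : seq lattice :=
  if (i <= 9)%N then [:: (-1, 0)]
  else if (i <= 12)%N then [:: (-1, 1); (-1, 0)]
  else if (i <= 14)%N then [:: (-1, 2); (-1, 1); (-1, 0)]
  else [:: (-1, 1); (-2, 1); (-1, 0)].

Definition normals (i : nat) (k : int) : seq lattice :=
  two_chains (map (shear k) (left_form i)) (right_form i).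

Definition normal (i : nat) (k : int) : nat -> lattice := cyclic (normals i k).

Lemma detz_shear k u v : detz (shear k u) (shear k v) = detz u v.
Proof. by rewrite /detz /shear /=; ring. Qed.

Lemma shear_e2 k : shear k e2 = e2.
Proof. by rewrite /shear /= mulr0 subr0. Qed.

Lemma shearN k u : shear k (- u) = - shear k u.
Proof. by apply: lattice_eq; rewrite /shear !latticeE /=; ring. Qed.

Lemma chain_shear k s : chain (map (shear k) s) = chain s.
Proof.
rewrite /chain all_map; congr (_ && _).
have -> : rcons (map (shear k) s) (- e2) = map (shear k) (rcons s (- e2)).
  by rewrite map_rcons shearN shear_e2.
rewrite -{1}(shear_e2 k) path_map; apply: eq_path => u v.
by rewrite /= /unidet detz_shear.
Qed.

Lemma family_cases (Q : nat -> Prop) :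
  Q 1%N -> Q 2%N -> Q 3%N -> Q 4%N -> Q 5%N -> Q 6%N -> Q 7%N -> Q 8%N ->
  Q 9%N -> Q 10%N -> Q 11%N -> Q 12%N -> Q 13%N -> Q 14%N -> Q 15%N ->
  forall i, (1 <= i <= 15)%N -> Q i.
Proof. by do 15!move=> ?; do 16?[case=> //]. Qed.

Lemma family_forms i : (1 <= i <= 15)%N ->
  [/\ chain (left_form i), chain (right_form i)
    & (size (left_form i) + size (right_form i))%N = 6%N].
Proof. by move: i; apply: family_cases; split; vm_compute. Qed.

Lemma size_normals i k : (1 <= i <= 15)%N -> size (normals i k) = 8%N.
Proof. by move=> /family_forms[_ _ sz]; rewrite size_two_chains size_map sz. Qed.

Lemma normal_cycleP i k : (1 <= i <= 15)%N -> normal_cycle 8 (normal i k).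
Proof.
move=> i15; have [fc gc sz] := family_forms i15.
have -> : 8%N = (size (map (shear k) (left_form i)) + size (right_form i)).+2.
  by rewrite size_map sz.
apply: two_chains_cycle; rewrite ?chain_shear //; move: i {fc gc sz} i15;
  exact: family_cases.
Qed.

Lemma vkE k : vk k = (-1, k).
Proof. by apply: lattice_eq; rewrite !latticeE /=; lia. Qed.

Lemma Sigma_rays_normals i k : (1 <= i <= 15)%N -> perm_eq (Sigma_rays i k) (normals i k).
Proof.
have perm (s t : seq lattice) (p : seq nat) :
    perm_eq p (iota 0 (size s)) -> t = [seq nth 0 s j | j <- p] -> perm_eq s t.
  move=> ps ->; rewrite perm_sym -[X in perm_eq _ X](mkseq_nth 0); exact: perm_map.
pose comp := (vkE, latticeD1, latticeD2, latticeN1, latticeN2, latticeMn1, latticeMn2).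
pose p := nth [::] [:: [::];
    [:: 0; 7; 6; 5; 4; 3; 1; 2];
    [:: 0; 6; 5; 4; 7; 3; 1; 2];
    [:: 0; 6; 5; 7; 4; 3; 1; 2];
    [:: 0; 5; 4; 7; 6; 3; 1; 2];
    [:: 0; 5; 4; 6; 7; 3; 1; 2];
    [:: 0; 5; 7; 4; 6; 3; 1; 2];
    [:: 0; 4; 5; 6; 7; 3; 1; 2];
    [:: 0; 4; 5; 7; 6; 3; 1; 2];
    [:: 0; 4; 7; 5; 6; 3; 1; 2];
    [:: 0; 7; 6; 5; 4; 1; 3; 2];
    [:: 0; 6; 5; 7; 4; 1; 3; 2];
    [:: 0; 5; 6; 7; 4; 1; 3; 2];
    [:: 0; 7; 6; 5; 1; 4; 3; 2];
    [:: 0; 6; 7; 5; 1; 4; 3; 2];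
    [:: 0; 6; 7; 5; 1; 3; 4; 2]]%N.
move=> i15; apply: (perm _ _ (p i)); move: i i15; apply: family_cases => //;
  rewrite /Sigma_rays /normals /=; do 8?congr cons => //;
  by apply: lattice_eq; rewrite !comp /=; ring.
Qed.

Section Lengths.
Variable R : realType.
Implicit Types (l : 6.-tuple R) (i : nat) (k : int).

(** The length of the edge of [Delta i k l] on the axis of ordinates is
    [Btot i l] minus this height. *)
Definition left_height i l : R :=
  if (i <= 9)%N then 0
  else if (i <= 12)%N then ell l 6
  else if (i <= 14)%N then ell l 5 + ell l 6
  else ell l 5 + ell l 6 *+ 2.

Definition lengths i k l : seq R :=
  top_right i l - asum i k l 0 :: rcons l (Btot i l - left_height i l).

Definition length_of i k l (j : nat) : R := (lengths i k l)`_(j %% 8).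

Lemma boundary_eq n (u : nat -> lattice) (L : nat -> R) (vs : seq (plane R)) :
  size vs = n -> vs`_0 = 0 ->
  (forall j, (j < n)%N -> vs`_(j.+1 %% n) = vs`_j + L j *: edge_dir (toR R (u j))) ->
  vs = boundary n u L /\ vertex u L n = 0.
Proof.
move=> sz v0 step; have vE j : (j < n)%N -> vertex u L j = vs`_j.
  elim: j => [|j IH] jn; first by rewrite v0 /vertex big_ord0.
  by rewrite vertexS IH ?(ltnW jn) // -step ?(ltnW jn) // modn_small.
split.
  apply: (@eq_from_nth _ 0) => [|j]; rewrite ?size_mkseq // sz => jn.
  by rewrite nth_mkseq // vE.
case: n sz step vE => [|n] sz step vE; first by rewrite /vertex big_ord0.
by rewrite vertexS vE // -step // modnn.
Qed.

Lemma Delta_boundary i k l : (1 <= i <= 15)%N ->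
  Delta_vertices i k l = boundary 8 (normal i k) (length_of i k l) /\
  vertex (normal i k) (length_of i k l) 8 = 0.
Proof.
move=> i15; apply: boundary_eq.
- by move: i i15; apply: family_cases.
- by rewrite /Delta_vertices.
move=> j j8.
case: l => -[//|l1 [//|l2 [//|l3 [//|l4 [//|l5 [//|l6 [|//]]]]]]] l6P.
rewrite /normal /cyclic (size_normals k i15) /length_of (modn_small j8).
move: i i15; apply: family_cases;
  case: j j8 => [|[|[|[|[|[|[|[|//]]]]]]]] _;
  rewrite /Delta_vertices /=; apply: plane_eq; rewrite !planeE /=;
  rewrite /left_height /Btot /asum /bsum /top_right /len_m /ell ?unlock /=;
  rewrite ?[index_iota _ _]/= /=; ring.
Qed.

(** Two of the lengths of a closed polygon with these normals, those of the
    edges through the origin, are determined by the six others. *)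
Lemma closed_lengths i k (L : nat -> R) : (1 <= i <= 15)%N ->
  edge_lengths 8 (normal i k) L ->
  exists2 l, admissible i k l & L = length_of i k l.
Proof.
move=> i15 [Lp L0 closed].
pose l := [tuple of [:: L 1; L 2; L 3; L 4; L 5; L 6]]%N.
have [L0E L7E] : L 0%N = length_of i k l 0 /\ L 7%N = length_of i k l 7.
  move: closed; rewrite /vertex !big_ord_recr big_ord0 /= => closed.
  move: (congr1 fst closed) (congr1 snd closed); rewrite !planeE /= {closed}.
  rewrite /length_of /normal /cyclic (size_normals k i15).
  move: i i15; apply: family_cases; rewrite /= /left_height /Btot /asum /bsum;
  rewrite /top_right /len_m /ell unlock /= => e1 e2;
  (split; [|apply: esym]; apply: subr0_eq);
  by [apply: etrans e1; ring|apply: etrans e2; ring].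
exists l; last first.
  apply/funext => j; have -> : L j = L (j %% 8)%N.
    rewrite {1}(divn_eq j 8) addnC; elim: (j %/ 8)%N => [|m IH]; first by rewrite addn0.
    by rewrite mulSn addnCA addnC Lp.
  have -> : length_of i k l j = length_of i k l (j %% 8) by rewrite /length_of modn_mod.
  have : (j %% 8 < 8)%N by rewrite ltn_mod.
  by case: (j %% 8)%N => [|[|[|[|[|[|[|[|//]]]]]]]].
have := L0 0%N; have := L0 7%N; rewrite {}L0E {}L7E.
rewrite /length_of /lengths /= !subr_gt0 => Bl al; split => //.
  by move=> [[|[|[|[|[|[|//]]]]]] j6]; rewrite (tnth_nth 0) /=.
by move: Bl; rewrite /left_height; do 3?case: ifP.
Qed.

Lemma admissible_lengths i k l : (1 <= i <= 15)%N -> admissible i k l ->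
  edge_lengths 8 (normal i k) (length_of i k l).
Proof.
move=> i15 [l0 al Bl]; have [_ closed] := Delta_boundary k l i15.
split=> // [j|j]; first by rewrite /length_of modnDr.
rewrite /length_of; have : (j %% 8 < 8)%N by rewrite ltn_mod.
case: (j %% 8)%N => [_|{}j]; first by rewrite /= subr_gt0.
rewrite /= ltnS nth_rcons size_tuple leq_eqVlt orbC ltnS => /orP[j6|/eqP[->]].
  by rewrite j6 -(tnth_nth 0 l (Ordinal j6)).
rewrite /= subr_gt0; have [i9|i9] := boolP (i <= 9)%N; last first.
  by move: Bl; rewrite /left_height (negbTE i9); do 2?case: ifP.
rewrite /left_height i9 /Btot /bsum.
have len : (0 < len_m i <= 5)%N by move: i i15 {al Bl closed i9}; exact: family_cases.
have term m : (0 < m < (len_m i).+1)%N -> 0 < ((coef_b i)`_m.-1)%:~R * ell l m.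
  case: m => // m; rewrite ltnS /= => mi; rewrite mulr_gt0 //; last first.
    have m6 : (m < 6)%N by case/andP: len => _; apply: leq_trans; exact: ltnW.
    by rewrite /ell /= -(tnth_nth 0 l (Ordinal m6)).
  rewrite ltr0z; move: i {al Bl closed i9 len} i15 mi; apply: family_cases;
  by rewrite /len_m; case: m => [|[|[|[|[|m]]]]].
rewrite big_nat_recl; last by case/andP: len.
apply: ltr_pwDl; first by apply: (term 1%N); case/andP: len.
rewrite big_seq; apply: sumr_ge0 => m; rewrite mem_index_iota => /andP[m1 mi].
by rewrite ltW // term // ltnW.
Qed.

End Lengths.

(** * The fans and octagons of the families *)

Section Families.
Variable R : realType.
Implicit Types (i : nat) (k : int) (l : 6.-tuple R).

(** Integral parameters, admissible when [N] is large. *)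
Definition lattice_lengths i (N : int) : 6.-tuple int :=
  if (i <= 9)%N then [tuple 1; 1; 1; 1; 1; N]
  else if (i <= 12)%N then [tuple 1; 1; 1; 1; N; 1]
  else [tuple 1; 1; 1; N; 1; 1].

Lemma lattice_lengths_admissible i k : (1 <= i <= 15)%N ->
  exists N, admissible i k (map_tuple (fun z : int => z%:~R : R) (lattice_lengths i N)).
Proof.
move=> i15; pose S := \sum_(a <- coef_a i k) a; exists (`|S| + 1).
have SN : S < `|S| + 1 by rewrite ltzD1 ler_norm.
have N0 : 0 < `|S| + 1 by rewrite ltzD1.
move: (`|S| + 1) SN N0 => N SN N0.
have NR : 0 < N%:~R :> R by rewrite ltr0z.
split.
- move=> j; rewrite tnth_map ltr0z /lattice_lengths.
  by do 2?case: ifP => _; case: j => [[|[|[|[|[|[|//]]]]]] ?].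
- have : S%:~R < N%:~R :> R by rewrite ltr_int.
  rewrite /S; clear SN S; move: i i15; apply: family_cases;
  rewrite /asum /top_right /len_m /ell unlock /=; lra.
- move: i i15 {S SN}; apply: family_cases => //=;
  rewrite /Btot /bsum /len_m /ell unlock /=; lra.
Qed.

Lemma boundary_lattice n u (L : nat -> R) : (forall j, exists z : int, L j = z%:~R) ->
  exists s, boundary n u L = map (toR R) s.
Proof.
move=> Lz; have /choice[q qE] j : exists p, vertex u L j = toR R p.
  elim: j => [|j [p pE]]; first by exists 0; rewrite /vertex big_ord0 toR0.
  have [z zE] := Lz j; exists (p + (z * (u j).2, - (z * (u j).1))).
  rewrite vertexS toRD pE zE; congr (_ + _).
  by apply: plane_eq; rewrite !planeE /= ?rmorphN rmorphM ?mulrN.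
by exists (mkseq q n); rewrite -map_comp; apply: eq_map.
Qed.

Lemma range_normal i k : (1 <= i <= 15)%N ->
  range (normal i k) = [set` Sigma_rays i k].
Proof.
move=> i15; apply/seteqP; split=> u /=.
  move=> [j _ <-]; rewrite (perm_mem (Sigma_rays_normals k i15)) mem_nth //.
  by rewrite ltn_mod size_normals.
rewrite (perm_mem (Sigma_rays_normals k i15)) => /(nthP 0)[j jn <-].
by exists j => //; rewrite /normal /cyclic modn_small.
Qed.

(** The normal fan of any admissible octagon is a complete fan with these rays,
    and there is only one. *)
Lemma SigmaE i k : (1 <= i <= 15)%N -> Sigma R i k = normal_fan R (normal i k).
Proof.
move=> i15; have uP := normal_cycleP k i15.
have [N /(admissible_lengths i15) LP] := lattice_lengths_admissible k i15.
have cF := normal_fan_complete uP LP; have rF := normal_fan_rays R uP.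
have /getPex[cS rS] : exists F, [set F : set (set (plane R)) |
    complete_fan F /\ ray_generators F = [set` Sigma_rays i k]] F.
  by exists (normal_fan R (normal i k)); rewrite /= -range_normal.
by apply: complete_fan_inj; rewrite // rF range_normal.
Qed.

Lemma Delta_conv i k l : (1 <= i <= 15)%N ->
  Delta i k l = conv (boundary 8 (normal i k) (length_of i k l)).
Proof. by move=> i15; rewrite /Delta; have [->] := Delta_boundary k l i15. Qed.

Lemma normal_cycle_inj n u : normal_cycle n u -> {in `I_n &, injective u}.
Proof.
move=> [n2 up ud turn] j k; rewrite !inE /= => jn kn.
wlog jk : j k jn kn / (j <= k)%N.
  by move=> H; case/orP: (leq_total j k) => jk ujk; [exact: H|apply/esym/H].
move=> ujk; apply/eqP; rewrite eqn_leq jk leqNgt; apply/negP => lt.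
have kE : k = (j + (k - j))%N by rewrite subnKC.
have jk0 : detz (u j) (u k) = 0 by rewrite ujk /detz; ring.
have [m0|m0] := ltnP (k - j).+1 n.
  have := turn j (k - j)%N; rewrite subn_gt0 lt m0 -kE jk0 => /(_ isT isT isT).
  by rewrite addnS -kE ujk ud.
have [j0 k0] : j = 0%N /\ k.+1 = n by lia.
by have := ud k; rewrite k0 -[n]add0n up -j0 detzC jk0.
Qed.

Theorem Sigma_smooth_projective i k : (1 <= i <= 15)%N ->
  smooth_projective_fan (Sigma R i k).
Proof.
move=> i15; have uP := normal_cycleP k i15.
have [N adm] := lattice_lengths_admissible k i15.
have LP := admissible_lengths i15 adm.
rewrite SigmaE //; split.
- exact: normal_fan_complete uP LP.
- exact: normal_fan_smooth uP LP.
- have [|s sE] := @boundary_lattice 8 (normal i k) (length_of i k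
    (map_tuple (fun z : int => z%:~R : R) (lattice_lengths i N))).
    move=> j; apply/intrP; set l := map_tuple _ _.
    have el m : ell l m \is a Num.int.
      rewrite /ell; have [mj|mj] := ltnP m.-1 6; last by rewrite nth_default ?size_tuple ?rpred0.
      by rewrite -(tnth_nth 0 l (Ordinal mj)) tnth_map intr_int.
    rewrite /length_of /lengths; case: (j %% 8)%N => [|m] /=.
      apply: rpredB; last by apply: rpred_sum => a _; rewrite rpredM ?intr_int.
      by rewrite /top_right; do 3?case: ifP => _; rewrite ?rpredD ?rpredMn.
    rewrite nth_rcons; case: ifP => [_|_]; first exact: (el m.+1).
    case: ifP => [_|_]; last exact: rpred0.
    apply: rpredB; first by apply: rpred_sum => a _; rewrite rpredM ?intr_int.
    by rewrite /left_height; do 3?case: ifP => _; rewrite ?rpredD ?rpredMn ?rpred0.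
  by exists s; rewrite -sE; exact: normal_fan_of_polygon.
Qed.

Theorem Sigma_picard_rank i k : (1 <= i <= 15)%N -> has_picard_rank (Sigma R i k) 6.
Proof.
move=> i15; have uP := normal_cycleP k i15.
have [N /(admissible_lengths i15) LP] := lattice_lengths_admissible k i15.
rewrite /has_picard_rank SigmaE // (normal_fan_rays R uP).
have -> : range (normal i k) = normal i k @` `I_8.
  apply/seteqP; split=> [_ [j _ <-]|_ [j _ <-]]; last by exists j.
  by exists (j %% 8)%N; rewrite /= ?ltn_mod //; apply: (u_mod uP); rewrite modn_mod.
exact: inj_card_eq (normal_cycle_inj uP).
Qed.

Theorem Delta_octagon i k l : (1 <= i <= 15)%N -> admissible i k l ->
  [/\ delzant (Delta i k l), octagon (Delta i k l)
    & has_inner_normal_fan (Delta i k l) (Sigma R i k)].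
Proof.
move=> i15 /(admissible_lengths i15) LP; have uP := normal_cycleP k i15.
rewrite Delta_conv // SigmaE //; split.
- exact: delzant_conv uP LP.
- exact: octagon_conv uP LP _.
- exact: normal_fan_of_polygon uP LP.
Qed.

Theorem polygon_of_Sigma i k P : (1 <= i <= 15)%N ->
  has_inner_normal_fan P (Sigma R i k) ->
  exists2 l, admissible i k l & exists t, P = translate t (Delta i k l).
Proof.
move=> i15 [[[s Ps] [x [y [z [Px _ _ _]]]]] ratP _].
have uP := normal_cycleP k i15.
have [N /(admissible_lengths i15) LP] := lattice_lengths_admissible k i15.
rewrite SigmaE // (normal_fan_rays R uP) => /esym normP.
have P0 : P !=set0 by exists x.
have [L [t [Lp PE]]] :=
  polygon_of_normals uP (no_normal_between uP LP) Ps P0 normP ratP.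
have [l adm LE] := closed_lengths i15 Lp.
by exists l => //; exists t; rewrite PE Delta_conv // LE.
Qed.

End Families.

(** * Rays of a smooth complete fan *)

Section SmoothRays.
Implicit Types (rs : seq lattice) (u v p q r s t x y : lattice).

Definition gap rs u v : Prop := forall r, r \in rs -> ~~ between u r v.

(** What the classification uses of the rays of a smooth complete fan.  Unlike
    the fan itself, this is immediately transported by a change of basis. *)
Definition smooth_rays rs : Prop :=
  [/\ {in rs, forall u, primitive u},
      forall u v, u \in rs -> v \in rs -> 0 < detz u v -> gap rs u v -> detz u v = 1
    & forall x, primitive x -> x \notin rs ->
        exists u v, [/\ u \in rs, v \in rs, 0 < detz u v, gap rs u v & between u x v]].

Lemma smooth_rays_of_fan (R : realType) (F : set (set (plane R))) rs :
  complete_fan F -> smooth_fan F -> ray_generators F = [set` rs] -> smooth_rays rs.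
Proof.
move=> cF sF Frs; have ray u : u \in rs <-> ray_generators F u by rewrite Frs.
split.
- by move=> u /ray[].
- move=> u v /ray Fu /ray Fv uv g; have Fuv : F (cone R [:: u; v]).
    by apply: fan_sector => // r /ray; exact: g.
  have [//|uv1] : detz u v = 1 \/ detz u v = -1.
    apply/Zbasis_det/sF; split=> // uE; move: uv.
    by rewrite uE /detz mulrC subrr.
  by rewrite uv1 in uv.
- move=> x px xrs; have [C FC Cx] := cF.2 (toR R x).
  have x0 : toR R x <> 0.
    by rewrite -(@toR0 R) => /(@toR_inj R)/eqP; apply/negP/primitive_neq0.
  have mult c u : ray_generators F u -> 0 <= c -> toR R x = c *: toR R u -> False.
    move=> Fu; rewrite le_eqVlt => /predU1P[<- xE|c0 xE].
      by apply: x0; rewrite xE scale0r.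
    by move/negP: xrs; apply; apply/ray; rewrite (ray_inj px Fu.1 c0 xE).
  have [CE|[u pu CE]|[u [v [pu pv uv CE]]]] := fan_planar cF FC; rewrite {}CE in FC Cx.
  + by rewrite cone_nil in Cx.
  + by case/cone1P: Cx => c c0 xE; case: (mult c u).
  + have Fu : ray_generators F u.
      split => //. exact: (fan_face cF FC (cone2_facel R uv)).
    have Fv : ray_generators F v by split => //; exact: (fan_face cF FC (cone2_facer R uv)).
    exists u, v; split=> //; [exact/ray|exact/ray| |].
      by move=> r /ray; exact: (fan_no_ray_inside cF uv FC).
    case/cone2P: Cx => a [b [a0 b0 xE]].
    have {}a0 : 0 < a.
      rewrite lt_neqAle a0 andbT; apply/eqP => aE; apply: (mult b v) => //.
      by rewrite xE -aE scale0r add0r.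
    have {}b0 : 0 < b.
      rewrite lt_neqAle b0 andbT; apply/eqP => bE; apply: (mult a u) => //.
        exact: ltW.
      by rewrite xE -bE scale0r addr0.
    by rewrite /between -!(det_toR_gt0 R) xE !detE !mulr0 add0r addr0 !mulr_gt0 ?det_toR_gt0.
Qed.

Lemma detz_basis p q x y : detz p q = 1 ->
  detz x y = detz x q * detz p y - detz p x * detz y q.
Proof.
move=> pq; rewrite -[LHS]mulr1 -pq /detz; ring.
Qed.

(** Suppose that no ray has an opposite.  If [- r] lies in the sector of [p]
    and [q], write vectors in the basis [p], [q], so that [r] is in the third
    quadrant.  The sector of [- p] goes from the second quadrant to the third or
    further; its minor being 1, it cannot have one side inside each of these
    quadrants, and as it cannot contain [r] either, it starts at [q].
    Likewise the sector of [- q] ends at [p].  The other sides of these two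
    sectors are [(-1, -b)] and [(-a, -1)], in this order only if both are
    [(-1, -1)], which leaves three rays. *)
Lemma opposite_rays rs : smooth_rays rs -> uniq rs -> (3 < size rs)%N ->
  exists2 r, r \in rs & - r \in rs.
Proof.
move=> [prim sm cov] urs rs3; apply: contrapT => noopp.
have opp u : u \in rs -> - u \in rs -> False by move=> ur nr; apply: noopp; exists u.
have par u v : u \in rs -> v \in rs -> detz u v = 0 -> v = u.
  move=> ur vr /(primitive_parallel (prim _ ur) (prim _ vr))[//|vE].
  by case: (opp u) => //; rewrite -vE.
have sect u : u \in rs -> exists s t, [/\ s \in rs, t \in rs, detz s t = 1,
    gap rs s t & between s (- u) t].
  move=> ur; have [||s [t [sr tr st g b]]] := cov (- u).
  - by rewrite primitiveN prim.
  - by apply/negP; exact: opp.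
  - by exists s, t; split => //; exact: sm.
have [r rr] : exists r, r \in rs by case: rs rs3 {prim sm cov urs noopp opp par sect} => // r s _; exists r; rewrite mem_head.
have [p [q [pr qr pq g /andP[]]]] := sect r rr.
have detN u v : detz u (- v) = - detz u v by rewrite /detz !latticeE; ring.
have Ndet u v : detz (- u) v = - detz u v by rewrite /detz !latticeE; ring.
rewrite detN Ndet !oppr_gt0 => b_r a_r.
have base x y := detz_basis x y pq.
have quad x : x \in rs -> 0 < detz p x -> 0 < detz x q -> False.
  by move=> /g /negP h px xq; apply: h; rewrite /between px.
have [s [s' [sr sr' ss gs /andP[]]]] := sect p pr.
rewrite detN Ndet !oppr_gt0 detzC oppr_lt0 => b_s b_s'.
have sq : q = s.
  have [a_s|a_s|a_s] := ltrgt0P (detz s q); last exact: par.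
    by case: (quad s).
  have := base s s'; rewrite ss => ss1.
  have [a_s'|a_s'|a_s'] := ltrgt0P (detz s' q).
  - have /negP := gs r rr; case; rewrite /between (base s r) (base r s'); nia.
  - nia.
  - by have E := par _ _ sr' qr a_s'; rewrite -E pq in b_s'.
have [t [t' [tr tr' tt gt /andP[]]]] := sect q qr.
rewrite detN Ndet !oppr_gt0 [detz q t']detzC oppr_lt0 => a_t a_t'.
have tp : t' = p.
  have [b_t|b_t|b_t] := ltrgt0P (detz p t'); last exact: par.
    by case: (quad t').
  have := base t t'; rewrite tt => tt1.
  have [b_t0|b_t0|b_t0] := ltrgt0P (detz p t).
  - have /negP := gt r rr; case; rewrite /between (base t r) (base r t'); nia.
  - nia.
  - by have E := par _ _ pr tr b_t0; rewrite E pq in a_t.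
rewrite -{s b_s sr}sq in ss gs; rewrite {t' a_t' tr'}tp in tt gt.
have as1 : detz s' q = -1 by move: ss; rewrite detzC; lia.
have bt1 : detz p t = -1 by move: tt; rewrite detzC; lia.
have ab : detz p s' = -1 /\ detz t q = -1.
  have [h|h] : detz p s' * detz t q <= 1 \/ 1 < detz p s' * detz t q by lia.
    nia.
  have /negP := gs t tr; case; rewrite /between (base t s') as1 bt1 detzC; lia.
case: ab => bs1 at1.
have three : {subset rs <= [:: p; q; s']}.
  move=> x xr; rewrite !inE.
  have h1 : detz p x <= 0 \/ detz x q <= 0.
    by have [h|h] := lerP (detz p x) 0; [left|right; rewrite leNgt; apply/negP; exact: quad].
  have /negP h2 := gs x xr; have /negP h3 := gt x xr.
  move: h2 h3; rewrite /between (base x s') (base t x) as1 bs1 bt1 at1.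
  rewrite [detz q x]detzC [detz x p]detzC => h2 h3.
  have [E|[E|E]] : detz x q = 0 \/ (detz p x = 0 \/ detz x q = detz p x) by lia.
  - by rewrite (par _ _ xr qr E) eqxx orbT.
  - by rewrite -(par _ _ pr xr E) eqxx.
  - have E' : detz s' x = 0 by rewrite (base s' x) as1 bs1; lia.
    by rewrite (par _ _ sr' xr E') eqxx !orbT.
by have := uniq_leq_size urs three; rewrite leqNgt rs3.
Qed.

End SmoothRays.

(** * Enumeration of the chains *)

Section Enumeration.
Implicit Types (s t f : seq lattice) (u v w a b : lattice) (k c : int).

Definition straight (n : nat) : seq lattice :=
  mkseq (fun j => (-1, (n.-1 - j)%N%:Z)) n.

Definition insertions f : seq (seq lattice) :=
  [seq take j.+1 f ++ (f`_j + f`_j.+1) :: drop j.+1 f | j <- iota 0 (size f).-1].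

Fixpoint forms (n : nat) : seq (seq lattice) :=
  if n is m.+1 then straight n :: flatten (map insertions (forms m)) else [:: [::]].

Lemma detz_opposite a b w : detz a w = 1 -> detz w b = 1 -> a + b = w *~ detz a b.
Proof.
move=> aw wb; apply: lattice_eq; rewrite !latticeE; move: aw wb; rewrite /detz => aw wb.
  have := congr1 ( *%R b.1) aw; have := congr1 ( *%R a.1) wb; lia.
have := congr1 ( *%R b.2) aw; have := congr1 ( *%R a.2) wb; lia.
Qed.

(** The sum of the two neighbours of a vector [w] is an integral multiple of
    [w].  If the abscissas are negative and that of [w] is the least of the three,
    it is once or twice [w], and twice only if the abscissas are equal; then they
    divide a minor equal to 1. *)
Lemma neighbours_sum w a b : detz a w = 1 -> detz w b = 1 -> w.1 < -1 ->
  w.1 <= a.1 < 0 -> w.1 <= b.1 < 0 -> w = a + b /\ detz a b = 1.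
Proof.
move=> aw wb w1 /andP[a1 a0] /andP[b1 b0]; have ab := detz_opposite aw wb.
suff ab1 : detz a b = 1 by rewrite ab ab1 mulr1z.
have := congr1 fst ab; rewrite !latticeE => ab1.
have c0 : 0 < detz a b by nia.
have [//|c2] : detz a b = 1 \/ 2 <= detz a b by lia.
have [aE bE] : a.1 = w.1 /\ b.1 = w.1 by nia.
have : w.1 * (w.2 - a.2) = 1 by move: aw; rewrite /detz aE; lia.
by move/mulz_eq1; lia.
Qed.

Lemma chain_contract s : chain s -> all (fun u => u.1 == -1) s \/
  exists s1 a b s2, s = s1 ++ [:: a, a + b, b & s2] /\ chain (s1 ++ [:: a, b & s2]).
Proof.
move=> sc; have [s0|s0] := eqVneq s [::]; first by left; rewrite s0.
have [w ws wmax] : exists2 w : lattice, w \in s &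
    forall u : lattice, u \in s -> w.1 <= u.1.
  exact: seq_argmin s0.
have [w1|w1] := leP (-1) w.1.
  left; apply/allP => u us; rewrite eq_le (le_trans w1 (wmax _ us)) andbT.
  have /andP[_ /allP/(_ _ us)] := sc; rewrite /=; lia.
right; case/splitPr: ws sc wmax => s1 s2 sc wmax.
have /andP[] := sc; rewrite rcons_cat cat_path all_cat /= => /and3P[p1 h1 p2].
move=> /and3P[/allP n1 _ /allP n2].
case/lastP: s1 sc wmax p1 h1 n1 => [|s1 a] sc wmax p1 h1 n1.
  by exfalso; move: h1; rewrite /unidet /detz /= => /eqP; lia.
case: s2 sc wmax p2 n2 => [|b s2] sc wmax p2 n2.
  by exfalso; move: p2; rewrite /= /unidet /detz /= andbT => /eqP; lia.
rewrite last_rcons in h1; move: p2; rewrite /= => /andP[wb p2].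
have a1 : w.1 <= a.1 < 0.
  by rewrite wmax ?n1 // ?mem_cat mem_rcons mem_head.
have b1 : w.1 <= b.1 < 0.
  by rewrite wmax ?n2 ?mem_head // mem_cat !inE eqxx !orbT.
move/eqP: h1 => aw; move/eqP: wb => wb.
have [wab ab1] := neighbours_sum aw wb w1 a1 b1.
exists s1, a, b, s2; split; first by rewrite -wab cat_rcons.
rewrite -cat_rcons /chain rcons_cat cat_path all_cat p1 last_rcons /=.
rewrite /unidet ab1 eqxx p2 /=; apply/and3P; split; first exact/allP.
  by case/andP: b1.
by apply/allP => u us; apply: n2; rewrite inE us orbT.
Qed.

Lemma vertical_next u v : u.1 = -1 -> v.1 = -1 -> detz u v = 1 -> v = (-1, u.2 - 1).
Proof. by rewrite /detz => u1 v1 uv; apply: lattice_eq => //=; lia. Qed.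

Lemma chain_straight s : chain s -> s != [::] -> all (fun u => u.1 == -1) s ->
  exists k, s = map (shear k) (straight (size s)).
Proof.
move=> sc s0 /allP s1; have sE j : (j < size s)%N -> s`_j = (-1, (s`_0).2 - j%:Z).
  elim: j => [|j IH] js.
    have /eqP := s1 _ (mem_nth 0 js); rewrite subr0; by case: (s`_0) => ? ? /= ->.
  have := @closed_chain_det s j.+1 sc (leqW js); rewrite /= !nth_rcons js (ltnW js).
  have /eqP v1 := s1 _ (mem_nth 0 js); rewrite (IH (ltnW js)).
  by move/vertical_next => /(_ erefl v1) ->; rewrite /= intS opprD addrA addrAC.
exists ((s`_0).2 - (size s).-1%:Z); apply: (@eq_from_nth _ 0) => [|j js].
  by rewrite size_map size_mkseq.
rewrite (nth_map 0) ?size_mkseq // nth_mkseq // sE // /shear /=.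
have jn : (j <= (size s).-1)%N by rewrite -ltnS (ltn_predK js).
by rewrite mulrN1 opprK -(subzn jn) [in RHS]addrC addrA subrK.
Qed.

Lemma shearD k u v : shear k (u + v) = shear k u + shear k v.
Proof. by apply: lattice_eq; rewrite /shear !latticeE /=; ring. Qed.

(** By contraction, every chain is built from a vertical one by insertions. *)
Lemma chain_forms s : chain s -> s != [::] ->
  exists k f, f \in forms (size s) /\ s = map (shear k) f.
Proof.
have [n] := ubnP (size s); elim: n s => // n IH s; rewrite ltnS => sn sc s0.
have [s1|[s1 [a [b [s2 [sE sc']]]]]] := chain_contract sc.
  have [k kE] := chain_straight sc s0 s1; exists k, (straight (size s)); split=> //.
  by move: s0; rewrite -size_eq0; case: (size s) => // m _; rewrite /= mem_head.
have sz : size s = (size (s1 ++ [:: a, b & s2])).+1.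
  by rewrite sE !size_cat /= !addnS.
have [||k [f [ff fE]]] := IH _ _ sc'; first by rewrite sz in sn.
  by case: (s1).
exists k, (take (size s1).+1 f ++ (f`_(size s1) + f`_(size s1).+1) :: drop (size s1).+1 f).
have szf : size f = size (s1 ++ [:: a, b & s2]) by rewrite fE size_map.
split.
  rewrite sz /= inE; apply/orP; right; apply/flattenP; exists (insertions f).
    exact: map_f.
  apply/mapP; exists (size s1) => //; rewrite mem_iota szf size_cat /= addnS /=; lia.
have nthE m : (m < size f)%N -> shear k f`_m = (map (shear k) f)`_m.
  by move=> mf; rewrite (nth_map 0).
have sf : (size f = size s1 + (size s2).+2)%N by rewrite szf size_cat.
rewrite map_cat /= map_take map_drop shearD !nthE ?sf; try lia.
rewrite -fE sE !nth_cat ltnn subnn /= ltnNge leqnSn /= subSn // subnn /=.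
rewrite -[s1 ++ [:: a, b & s2]]cat_rcons take_size_cat ?size_rcons //.
by rewrite drop_size_cat ?size_rcons // cat_rcons.
Qed.

End Enumeration.

(** * Sorting the rays of a half plane *)

Section Classification.
Implicit Types (rs s t f : seq lattice) (u v w r : lattice) (k c : int) (g : 'M[int]_2).

Lemma lattice_actN g u : lattice_act g (- u) = - lattice_act g u.
Proof. by apply: lattice_eq; rewrite /lattice_act !latticeE /=; ring. Qed.

Lemma smooth_rays_act g rs : g \in unitmx -> det2 g = 1 ->
  smooth_rays rs -> smooth_rays (map (lattice_act g) rs).
Proof.
move=> gu g1 [prim sm cov].
have dE u v : detz (lattice_act g u) (lattice_act g v) = detz u v.
  by rewrite detz_act g1 mul1r.
have gapE u v : gap rs u v <->
    gap (map (lattice_act g) rs) (lattice_act g u) (lattice_act g v).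
  split=> [H _ /mapP[r rr ->]|H r rr]; first by rewrite /between !dE; exact: H.
  by rewrite /between -[detz u r]dE -[detz r v]dE; exact/H/map_f.
have gK : cancel (lattice_act (invmx g)) (lattice_act g).
  by move=> u; rewrite -lattice_actM mulmxV // lattice_act1.
split.
- by move=> _ /mapP[u ur ->]; apply: primitive_act; rewrite ?prim.
- by move=> _ _ /mapP[u ur ->] /mapP[v vr ->]; rewrite dE => uv /gapE; exact: sm.
- move=> x; rewrite -(gK x); move: (lattice_act _ x) => {}x px xr.
  have [||u [v [ur vr uv H b]]] := cov x.
  + rewrite -[x](_ : lattice_act (invmx g) (lattice_act g x) = x).
      by apply: primitive_act; rewrite ?unitmx_inv.
    by rewrite -lattice_actM mulVmx // lattice_act1.
  + by apply: contra xr; exact: map_f.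
  exists (lattice_act g u), (lattice_act g v); split; rewrite ?map_f ?dE //.
    exact/gapE.
  by rewrite /between !dE.
Qed.

(** When the rays of the left half plane are sorted by the sign of their minors,
    there is no ray between two consecutive ones, so that smoothness makes the
    minors of consecutive rays equal to 1. *)
Lemma left_chain rs : smooth_rays rs -> uniq rs -> e2 \in rs -> - e2 \in rs ->
  exists s, [/\ chain s, s != [::] & s =i [seq u <- rs | u.1 < 0]].
Proof.
move=> [prim sm cov] urs e2r Ne2r.
pose le u v := 0 <= detz u v; pose neg := [pred u : lattice | u.1 < 0].
pose s := sort le [seq u <- rs | u.1 < 0].
have sE u : (u \in s) = (u.1 < 0) && (u \in rs) by rewrite mem_sort mem_filter.
have sneg : all neg s by apply/allP => u; rewrite sE => /andP[].
have us : uniq s by rewrite sort_uniq filter_uniq.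
have le_refl : {in neg, reflexive le} by move=> u _; rewrite /le /detz mulrC subrr.
have le_tr : {in neg & &, transitive le}.
  move=> v u w v0 u0 w0; rewrite /le => uv vw; rewrite !inE in v0 u0 w0.
  have : v.1 * detz u w = u.1 * detz v w + w.1 * detz u v by rewrite /detz; ring.
  move=> E; suff : v.1 * detz u w <= 0 by rewrite nmulr_rle0.
  by rewrite E -[leRHS]addr0 lerD // mulr_le0_ge0 // ltW.
have le_total : {in neg &, total le}.
  by move=> u v _ _; rewrite /le [detz v u]detzC oppr_ge0; case: ltgtP.
have sorted_s : sorted le s.
  by apply: (sort_sorted_in le_total); rewrite all_filter; apply/allP => u _; exact/implyP.
have s_lt i j : (i < j < size s)%N -> 0 < detz s`_i s`_j.
  move=> /andP[ij js]; have is_ := ltn_trans ij js.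
  have := sorted_leq_nth_in le_tr le_refl 0 sneg sorted_s _ _ is_ js (ltnW ij).
  rewrite /le le_eqVlt => /predU1P[/esym d0|//].
  have si : s`_i \in s by rewrite mem_nth.
  have sj : s`_j \in s by rewrite mem_nth.
  have [/eqP|sji] := primitive_parallel (prim _ (andP (etrans (esym (sE _)) si)).2)
    (prim _ (andP (etrans (esym (sE _)) sj)).2) d0.
    by rewrite nth_uniq // gtn_eqF.
  have := allP sneg _ si; have := allP sneg _ sj; rewrite sji /= oppr_lt0; lia.
have s0 : s != [::].
  have [x [xs x0]] : exists u, u \in rs /\ u.1 < 0.
    have [xr|xr] := boolP ((-1, 0) \in rs); first by exists (-1, 0).
    have [u [v [ur vr uv _ /andP[]]]] := cov (-1, 0) isT xr.
    have [u0|u0] := ltP u.1 0; first by exists u.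
    have [v0|v0] := ltP v.1 0; first by exists v.
    rewrite /detz /= mulr0 mulrN1 sub0r opprK mulN1r mul0r subr0 oppr_gt0 => u2 v2.
    have := mulr_ge0_le0 u0 (ltW v2); have := mulr_ge0 (ltW u2) v0.
    by move: uv; rewrite /detz; lia.
  by apply/eqP => E; have := sE x; rewrite E x0 xs.
pose c := closed_chain s.
have cE j : (j < size s)%N -> c`_j.+1 = s`_j by move=> js; rewrite /c /= nth_rcons js.
have clast : c`_(size s).+1 = - e2 by rewrite /c /= nth_rcons ltnn eqxx.
have e2lt u : u.1 < 0 -> 0 < detz e2 u by rewrite /detz /=; lia.
have lte2 u : u.1 < 0 -> 0 < detz u (- e2) by rewrite /detz !latticeE /=; lia.
have sneg' j : (j < size s)%N -> (s`_j).1 < 0 by move=> js; exact: (allP sneg) (mem_nth 0 js).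
have c_lt i j : (i < j < (size s).+2)%N -> (0 < i)%N || (j < (size s).+1)%N ->
    0 < detz c`_i c`_j.
  case: j => // j /andP[ij js].
  case: i ij => [|i] ij ends.
    by rewrite cE; [exact: (e2lt _ (sneg' _ _))|case/orP: ends].
  move: js; rewrite ltnS leq_eqVlt => /predU1P[[jE]|js].
    by rewrite jE in ij *; rewrite clast cE //; apply/lte2/sneg'.
  by rewrite !cE ?s_lt //; [rewrite -ltnS ij|exact: ltn_trans ij js].
have c_in j : (j < (size s).+2)%N -> c`_j \in rs.
  case: j => // j; rewrite ltnS leq_eqVlt => /predU1P[[->]|js].
    by rewrite clast.
  by rewrite cE //; have := mem_nth 0 js; rewrite sE => /andP[].
have s1 : (0 < size s)%N by rewrite lt0n size_eq0.
have chain_s : chain s.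
  apply/andP; split; last exact: sneg.
  apply/(pathP 0) => i; rewrite size_rcons => iS; apply/eqP; rewrite -/c.
  change (detz c`_i c`_i.+1 = 1).
  have lt : 0 < detz c`_i c`_i.+1 by apply: c_lt; [rewrite ltnSn ltnS|case: (i); rewrite // ltnS s1].
  apply: sm => //; [exact: c_in (leqW iS)|exact: c_in|].
  move=> r rr; apply/negP => /andP[ir ri].
  have r0 : r.1 < 0.
    suff : r.1 * detz c`_i c`_i.+1 < 0 by rewrite pmulr_llt0.
    have -> : r.1 * detz c`_i c`_i.+1 =
        (c`_i).1 * detz r c`_i.+1 + (c`_i.+1).1 * detz c`_i r by rewrite /detz; ring.
    have [i0|i0] := posnP i.
      have c1 : (c`_i.+1).1 < 0 by rewrite i0 cE ?sneg'.
      have c0 : (c`_i).1 = 0 by rewrite i0.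
      by rewrite c0 mul0r add0r nmulr_rlt0.
    have ci : (c`_i).1 < 0 by rewrite -(prednK i0) cE ?sneg' // -ltnS prednK.
    apply: ltr_wnDr; last by rewrite nmulr_rlt0.
    rewrite mulr_le0_ge0 ?(ltW ir) //; move: iS; rewrite leq_eqVlt => /predU1P[[->]|iS].
      by rewrite clast.
    by rewrite cE // ltW // sneg'.
  have /(nthP 0)[j js rE] : r \in s by rewrite sE r0.
  have {}rE : r = c`_j.+1 by rewrite cE.
  have [ji|ij|ji] := ltngtP j.+1 i.
  - have lt' : 0 < detz c`_j.+1 c`_i by apply: c_lt; rewrite // ji leqW.
    by rewrite -rE detzC oppr_gt0 ltNge (ltW ir) in lt'.
  - move: ij; rewrite ltnS leq_eqVlt => /predU1P[ij|ij].
      by move: ri; rewrite rE ij /detz mulrC subrr.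
    have lt' : 0 < detz c`_i.+1 c`_j.+1 by apply: c_lt; rewrite // ltnS ij !ltnS ltnW.
    by rewrite -rE detzC oppr_gt0 ltNge (ltW ri) in lt'.
  - by move: ir; rewrite rE ji /detz mulrC subrr.
by exists s; split => // u; rewrite mem_sort.
Qed.

End Classification.

(** * Symmetries of a pair of chains *)

Section Symmetries.
Implicit Types (rs s t f : seq lattice) (u v w r : lattice) (k c : int) (g : 'M[int]_2).

Lemma mem_two_chains s t u :
  (u \in two_chains s t) = [|| u == e2, u == - e2, u \in s | - u \in t].
Proof.
have tE : (u \in map -%R t) = (- u \in t).
  by rewrite -{1}[u]opprK (mem_map oppr_inj).
by rewrite /two_chains inE mem_cat inE tE; congr (_ || _); rewrite orbCA.
Qed.

Lemma GL2_equiv_mem g (l l' : seq lattice) : g \in unitmx -> l =i map (lattice_act g) l' ->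
  GL2_equiv [set` l] [set` l'].
Proof.
move=> gu ll; exists g => //; apply/seteqP; split=> u /=.
  by rewrite ll => /mapP[v vl ->]; exists v.
by case=> v vl <-; rewrite ll map_f.
Qed.

Lemma two_chains_swap s t : GL2_equiv [set` two_chains s t] [set` two_chains t s].
Proof.
apply: (@GL2_equiv_mem (mx2 (-1) 0 0 (-1))); first by apply: det2_unitmx; left.
move=> u; have gE v : lattice_act (mx2 (-1) 0 0 (-1)) v = - v.
  by apply: lattice_eq; rewrite lattice_act_mx2 !latticeE /=; ring.
rewrite (eq_map gE) -{2}[u]opprK (mem_map oppr_inj) !mem_two_chains opprK.
rewrite !eqr_oppLR opprK.
by case: (u == e2); case: (u == - e2); case: (u \in s); case: (- u \in t).
Qed.

Definition reflect2 u : lattice := (u.1, - u.2).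

Lemma reflect2K : involutive reflect2.
Proof. by move=> u; apply: lattice_eq; rewrite /reflect2 /= ?opprK. Qed.

Lemma mem_map_involutive (T : eqType) (h : T -> T) (l : seq T) x :
  involutive h -> (x \in map h l) = (h x \in l).
Proof. by move=> hK; rewrite -{1}[x]hK (mem_map (inv_inj hK)). Qed.

Lemma two_chains_reflect s t :
  GL2_equiv [set` two_chains s t] [set` two_chains (map reflect2 s) (map reflect2 t)].
Proof.
apply: (@GL2_equiv_mem (mx2 1 0 0 (-1))); first by apply: det2_unitmx; right.
move=> u; have gE v : lattice_act (mx2 1 0 0 (-1)) v = reflect2 v.
  by apply: lattice_eq; rewrite lattice_act_mx2 /reflect2 /=; ring.
rewrite (eq_map gE) (mem_map_involutive _ _ reflect2K) !mem_two_chains.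
rewrite !(mem_map_involutive _ _ reflect2K) reflect2K.
have -> : reflect2 (- reflect2 u) = - u.
  by apply: lattice_eq; rewrite /reflect2 !latticeE /= ?opprK.
rewrite !(can2_eq reflect2K reflect2K).
have -> : reflect2 e2 = - e2 by [].
have -> : reflect2 (- e2) = e2 by [].
by case: (u == e2); case: (u == - e2).
Qed.

Lemma two_chains_shear c s t : GL2_equiv [set` two_chains s t]
  [set` two_chains (map (shear c) s) (map (shear c) t)].
Proof.
apply/GL2_equiv_sym/(@GL2_equiv_mem (mx2 1 0 (- c) 1)).
  by apply: det2_unitmx; left; rewrite mulr1 mul0r subr0.
move=> u; have gE v : lattice_act (mx2 1 0 (- c) 1) v = shear c v.
  by apply: lattice_eq; rewrite lattice_act_mx2 /shear /=; ring.
rewrite (eq_map gE) /two_chains /= map_cat /= shearN !shear_e2 -!map_comp.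
by congr (_ \in _ :: _ ++ _ :: _); apply: eq_map => v; rewrite /= shearN.
Qed.

Lemma shear_shear k c u : shear k (shear c u) = shear (k + c) u.
Proof. by apply: lattice_eq; rewrite /shear /=; ring. Qed.

Lemma reflect2_shear k u : reflect2 (shear k u) = shear (- k) (reflect2 u).
Proof. by apply: lattice_eq; rewrite /shear /reflect2 /=; ring. Qed.

(** The chains [f] and [f'] are, up to shears, those of a family.  The ordinates
    involved are small enough for shears by at most 6 to suffice. *)
Definition matches f f' : bool :=
  has (fun i =>
    has (fun c => perm_eq f (map (shear c) (left_form i))) [seq n%:Z - 6 | n <- iota 0 13]
 && has (fun c => perm_eq f' (map (shear c) (right_form i))) [seq n%:Z - 6 | n <- iota 0 13])
  (iota 1 15).

Definition is_family (A : set lattice) : Prop :=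
  exists i k, (1 <= i <= 15)%N /\ GL2_equiv A [set` Sigma_rays i k].

Lemma is_family_equiv A B : GL2_equiv A B -> is_family B -> is_family A.
Proof. by move=> AB [i [k [i15 Bi]]]; exists i, k; split => //; exact: GL2_equiv_trans Bi. Qed.

Lemma matches_family f f' k k' : matches f f' ->
  is_family [set` two_chains (map (shear k) f) (map (shear k') f')].
Proof.
case/hasP => i; rewrite mem_iota => i15 /andP[/hasP[c _ fc] /hasP[c' _ fc']].
exists i, (k + c - (k' + c')); split; first by lia.
apply: GL2_equiv_trans (two_chains_shear (- (k' + c')) _ _) _.
apply: (@GL2_equiv_mem 1%:M); first exact: unitmx1.
move=> u; rewrite (eq_map lattice_act1) map_id (perm_mem (Sigma_rays_normals _ _)); last by lia.
have shearP d l l' : perm_eq l (map (shear d) l') ->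
    forall e h, map (shear e) (map (shear h) l) =i map (shear (e + h + d)) l'.
  move=> ll e h x; rewrite (perm_mem (perm_map _ (perm_map _ ll))) -!map_comp.
  by congr (_ \in _); apply: eq_map => y /=; rewrite !shear_shear.
rewrite !mem_two_chains (shearP _ _ _ fc) (shearP _ _ _ fc').
have -> : - (k' + c') + k + c = k + c - (k' + c') by ring.
have -> : - (k' + c') + k' + c' = 0 by ring.
have -> : map (shear 0) (right_form i) = right_form i.
  by apply: map_id_in => y _; apply: lattice_eq; rewrite /shear //= mul0r subr0.
by [].
Qed.

(** A finite verification.  The symmetries cannot be dispensed with: up to shears
    there are fourteen chains of five vectors, of which the families contain nine,
    one from each orbit under reflection. *)
Lemma forms_match (a : nat) f f' : (0 < a < 6)%N -> f \in forms a -> f' \in forms (6 - a) ->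
  [|| matches f f', matches f' f, matches (map reflect2 f) (map reflect2 f')
    | matches (map reflect2 f') (map reflect2 f)].
Proof.
have check : all (fun a => all (fun f => all (fun f' =>
  [|| matches f f', matches f' f, matches (map reflect2 f) (map reflect2 f')
    | matches (map reflect2 f') (map reflect2 f)]) (forms (6 - a))) (forms a)) (iota 1 5).
  by vm_compute.
move=> a6 fa f'a; move/allP: check => /(_ a); rewrite mem_iota => /(_ a6).
by move=> /allP/(_ _ fa)/allP/(_ _ f'a).
Qed.

Lemma forms_family (a : nat) f f' k k' :
  (0 < a < 6)%N -> f \in forms a -> f' \in forms (6 - a) ->
  is_family [set` two_chains (map (shear k) f) (map (shear k') f')].
Proof.
move=> a6 fa f'a.
have refl l e : map reflect2 (map (shear e) l) = map (shear (- e)) (map reflect2 l).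
  by rewrite -!map_comp; apply: eq_map => u /=; rewrite reflect2_shear.
case/or4P: (forms_match a6 fa f'a) => m.
- exact: matches_family.
- by apply: is_family_equiv (two_chains_swap _ _) _; exact: matches_family.
- apply: is_family_equiv (two_chains_reflect _ _) _.
  by rewrite !refl; exact: matches_family.
- apply: is_family_equiv (two_chains_swap _ _) _.
  apply: is_family_equiv (two_chains_reflect _ _) _.
  by rewrite !refl; exact: matches_family.
Qed.

(** * Classification *)

(** A ray and its opposite are moved to [e2] and [- e2]; the other rays form a
    chain on each side. *)
Lemma smooth_rays_two_chains rs : smooth_rays rs -> uniq rs -> size rs = 8%N ->
  exists s t, [/\ chain s, chain t, (size s + size t = 6)%N,
    s != [::] /\ t != [::] & GL2_equiv [set` rs] [set` two_chains s t]].
Proof.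
move=> smr urs rs8; have [|r rr Nrr] := opposite_rays smr urs; first by rewrite rs8.
have [prim _ _] := smr; have /coprimezP[[x y] /= xy] := prim _ rr.
pose g := mx2 r.2 (- r.1) x y.
have g1 : det2 g = 1 by rewrite /det2 /g !mxE /= -[RHS]xy; ring.
have gu : g \in unitmx by apply: det2_unitmx; left; rewrite -[RHS]xy; ring.
have gr : lattice_act g r = e2.
  by apply: lattice_eq; rewrite lattice_act_mx2 /= -?[RHS]xy; ring.
have act_inj h : h \in unitmx -> injective (lattice_act h).
  move=> hu; apply: (can_inj (g := lattice_act (invmx h))) => u.
  by rewrite -lattice_actM mulVmx // lattice_act1.
pose rs1 := map (lattice_act g) rs.
have smr1 : smooth_rays rs1 by exact: smooth_rays_act.
have urs1 : uniq rs1 by rewrite map_inj_uniq //; exact: act_inj.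
have e2r : e2 \in rs1 by rewrite -gr map_f.
have Ne2r : - e2 \in rs1 by rewrite -gr -lattice_actN map_f.
pose h := mx2 (-1) 0 0 (-1); have hu : h \in unitmx by apply: det2_unitmx; left.
have hE v : lattice_act h v = - v.
  by apply: lattice_eq; rewrite lattice_act_mx2 !latticeE /=; ring.
have [s [sc s0 sE]] := left_chain smr1 urs1 e2r Ne2r.
have [||||t [tc t0 tE]] := @left_chain (map (lattice_act h) rs1).
- by apply: smooth_rays_act; rewrite // /det2 !mxE.
- by rewrite map_inj_uniq //; exact: act_inj.
- by rewrite -[e2]opprK -hE map_f.
- by rewrite -hE map_f.
have rsE : rs1 =i two_chains s t.
  move=> u; rewrite mem_two_chains sE tE !mem_filter (eq_map hE) (mem_map oppr_inj).
  rewrite latticeE oppr_lt0; have [->|ue2] := eqVneq u e2; first by [].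
  have [->|uNe2] := eqVneq u (- e2); first by [].
  case: ltrgt0P => u1 //=; rewrite ?orbF //.
  apply/negP => ur; have [p1 _ _] := smr1.
  have [ue|ue] : u = e2 \/ u = - e2.
    by apply: primitive_parallel => //; [exact: p1|rewrite /detz u1 /=; ring].
  - by rewrite ue eqxx in ue2.
  - by rewrite ue eqxx in uNe2.
exists s, t; split=> //.
  have uP := two_chains_cycle sc tc s0 t0.
  have ust : uniq (two_chains s t).
    apply/(uniqP 0) => i j; rewrite !inE => ii jj ij.
    apply: (normal_cycle_inj uP); rewrite ?inE /= -?size_two_chains //.
    by rewrite /cyclic !modn_small.
  have := perm_size (uniq_perm urs1 ust rsE).
  by rewrite size_map rs8 size_two_chains => -[].
apply: GL2_equiv_sym; exists g => //; apply/seteqP; split=> u /=.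
  by rewrite -rsE => /mapP[v vr ->]; exists v.
by case=> v vr <-; rewrite -rsE map_f.
Qed.

Theorem smooth_rays_family rs : smooth_rays rs -> uniq rs -> size rs = 8%N ->
  is_family [set` rs].
Proof.
move=> smr urs rs8.
have [s [t [sc tc st [s0 t0] rst]]] := smooth_rays_two_chains smr urs rs8.
apply: is_family_equiv rst _.
have [k [f [fs ->]]] := chain_forms sc s0; have [k' [f' [f's ->]]] := chain_forms tc t0.
move: s0 t0; rewrite -!size_eq0 => s0 t0.
apply: (@forms_family (size s)) => //; last by rewrite -st addKn.
by rewrite lt0n s0 -st -[X in (X < _)%N]addn0 ltn_add2l lt0n.
Qed.

End Symmetries.

Theorem classification (R : realType) (F : set (set (plane R))) :
  smooth_projective_fan F -> has_picard_rank F 6 ->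
  exists (i : nat) (k : int) (g : 'M[int]_2),
    [/\ (1 <= i <= 15)%N, g \in unitmx & F = GL2_act_fan g (Sigma R i k)].
Proof.
move=> [cF sF _] F8; pose rs : seq lattice := finmap.enum_fset (fset_set (ray_generators F)).
have Frs : ray_generators F = [set` rs].
  have fin : finite_set (ray_generators F) by apply/finite_setP; exists 8%N.
  by apply/seteqP; split=> u /=; rewrite in_fset_set // inE.
have [|||i [k [i15 [g gu rsE]]]] := @smooth_rays_family rs.
- exact: smooth_rays_of_fan Frs.
- exact: finmap.fset_uniq.
- exact: card_fset_set.
exists i, k, g; split => //.
have [cS _ _] := Sigma_smooth_projective R k i15.
have rS : ray_generators (Sigma R i k) = [set` Sigma_rays i k].
  by rewrite SigmaE // (normal_fan_rays R (normal_cycleP k i15)) range_normal.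
by rewrite (complete_fanE cF) (complete_fanE cS) fan_of_rays_act // Frs rsE rS.
Qed.

Theorem theorem3p1 (R : realType) :
  [/\ forall F : set (set (plane R)),
        smooth_projective_fan F -> has_picard_rank F 6 ->
        exists (i : nat) (k : int) (g : 'M[int]_2),
          [/\ (1 <= i <= 15)%N, g \in unitmx
            & F = GL2_act_fan g (Sigma R i k)],
      forall (i : nat) (k : int), (1 <= i <= 15)%N ->
        forall P : set (plane R), has_inner_normal_fan P (Sigma R i k) ->
        exists2 l : 6.-tuple R, admissible i k l
          & exists t : plane R, P = translate t (Delta i k l)
    & forall (i : nat) (k : int), (1 <= i <= 15)%N ->
        [/\ smooth_projective_fan (Sigma R i k),
            has_picard_rank (Sigma R i k) 6
          & forall l : 6.-tuple R, admissible i k l ->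
              [/\ delzant (Delta i k l), octagon (Delta i k l)
                & has_inner_normal_fan (Delta i k l) (Sigma R i k)]]].
Proof.
split=> [F|i k i15 P|i k i15].
- exact: classification.
- exact: polygon_of_Sigma.
- split; [exact: Sigma_smooth_projective|exact: Sigma_picard_rank|].
  by move=> l; exact: Delta_octagon.
Qed.
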